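(* Let $\mathcal{Q}\subset\mathbb{P}^2$ be a plane quartic curve over $\mathbb{C}$ which is either an irreducible singular quartic curve, or $\mathcal{Q}=\mathcal{C}_1+\mathcal{C}_2$ with $\mathcal{C}_1,\mathcal{C}_2$ two smooth conics meeting transversally, and let $z_o$ be a general smooth point of $\mathcal{Q}$. Let $\varphi_{\mathcal{Q},z_o}:S_{\mathcal{Q},z_o}\to\mathbb{P}^1$ be the associated rational elliptic surface, with the map $\overline{f}_{\mathcal{Q},z_o}:S_{\mathcal{Q},z_o}\to\mathbb{P}^2$. Let $s_1,s_2,s_3\in\mathrm{MW}(S_{\mathcal{Q},z_o})$ be three line-sections and put $P_4=P_{s_1}\dot{+}P_{s_2}\dot{+}P_{s_3}$. If the section $s_{P_4}$ corresponding to $P_4$ is a line-section and $\overline{f}_{\mathcal{Q},z_o}(s_i)\neq\overline{f}_{\mathcal{Q},z_o}(s_j)$ for all distinct $i,j\in\{1,2,3\}$, then all the points of intersection of $\mathcal{Q}$ with the four lines $\overline{f}_{\mathcal{Q},z_o}(s_1)$, $\overline{f}_{\mathcal{Q},z_o}(s_2)$, $\overline{f}_{\mathcal{Q},z_o}(s_3)$ and $\overline{f}_{\mathcal{Q},z_o}(s_{P_4})$ lie on a conic.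
   Context: The base field is $\mathbb{C}$. ''General smooth point'': in particular the tangent line $l_{z_o}$ to $\mathcal{Q}$ at $z_o$ meets $\mathcal{Q}$ at $z_o$ and at two further distinct points. Construction of $S_{\mathcal{Q},z_o}$. Let $q_1:(\mathbb{P}^2_{z_o})'\to\mathbb{P}^2$ be the blowing-up at $z_o$, with exceptional curve $\Delta_1$, and let $\overline{l}_{z_o}$ be the proper transform of $l_{z_o}$. Let $q_2:\mathbb{P}^2_{z_o}\to(\mathbb{P}^2_{z_o})'$ be the blowing-up at the point $\overline{l}_{z_o}\cap\Delta_1$, and put $q_{z_o}=q_1\circ q_2$. Let $f':S'_{\mathcal{Q},z_o}\to\mathbb{P}^2_{z_o}$ be the double cover branched along $\overline{\mathcal{Q}}+\Delta$, where $\overline{\mathcal{Q}}$ and $\Delta$ are the proper transforms of $\mathcal{Q}$ and $\Delta_1$ in $\mathbb{P}^2_{z_o}$. Let $\mu:S_{\mathcal{Q},z_o}\to S'_{\mathcal{Q},z_o}$ be the canonical resolution, and put $\overline{f}_{\mathcal{Q},z_o}=q_{z_o}\circ f'\circ\mu:S_{\mathcal{Q},z_o}\to\mathbb{P}^2$. The pencil of lines through $z_o$ induces a relatively minimal elliptic fibration $\varphi_{\mathcal{Q},z_o}:S_{\mathcal{Q},z_o}\to\mathbb{P}^1$, and the preimage of $\Delta$ under $f'\circ\mu$ gives a section $O$ of it. The generic fiber $E_{S_{\mathcal{Q},z_o}}$ is an elliptic curve over $\mathbb{C}(t)$ with zero $O$. Let $\mathrm{MW}(S_{\mathcal{Q},z_o})$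 be the set of sections of $\varphi_{\mathcal{Q},z_o}$; it is identified with $E_{S_{\mathcal{Q},z_o}}(\mathbb{C}(t))$. For a section $s$, $P_s$ is the corresponding rational point, and for a rational point $P$, $s_P$ is the corresponding section. A section is identified with its image curve in $S_{\mathcal{Q},z_o}$. The symbol $\dot{+}$ denotes addition in the group law of the elliptic curve. A section $s\in\mathrm{MW}(S_{\mathcal{Q},z_o})$ is called a line-section (of $L$) if $\overline{f}_{\mathcal{Q},z_o}(s)$ is a line $L$ in $\mathbb{P}^2$. *)

(* Defs.v *)
From HB Require Import structures.
From mathcomp Require Import all_boot all_order all_algebra.
From mathcomp Require Export mpoly.
From mathcomp Require Export complex.
From mathcomp Require Export classical_sets reals.

Set Implicit Arguments.
Unset Strict Implicit.
Unset Printing Implicit Defensive.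

Import GRing.Theory.
Local Open Scope ring_scope.
Local Open Scope classical_set_scope.

(* Subsets of the projective plane are represented by the scaling-invariant   *)
(* sets of nonzero row vectors lying over them.                               *)

Definition proj_point (k : fieldType) (v : 'rV[k]_3) : set 'rV[k]_3 :=
  [set u : 'rV[k]_3 | u != 0 /\ (u == v)%MS].

Definition line (k : fieldType) (l : 'rV[k]_3) : set 'rV[k]_3 :=
  [set v : 'rV[k]_3 | v != 0 /\ v *m l^T = 0].

Definition curve (k : fieldType) (F : {mpoly k[3]}) : set 'rV[k]_3 :=
  [set v : 'rV[k]_3 | v != 0 /\ F.@[v 0] = 0].

Definition gradient (k : fieldType) (F : {mpoly k[3]}) (v : 'rV[k]_3) :
  'rV[k]_3 := \row_i (mderiv i F).@[v 0].

Definition singular_at (k : fieldType) (F : {mpoly k[3]}) (v : 'rV[k]_3) :=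
  curve F v /\ gradient F v = 0.

Definition irreducible_mpoly (k : fieldType) (F : {mpoly k[3]}) :=
  [/\ F != 0, F \isn't a GRing.unit &
    forall G H : {mpoly k[3]},
      F = G * H -> G \is a GRing.unit \/ H \is a GRing.unit].

Definition smooth_conic (k : fieldType) (G : {mpoly k[3]}) :=
  G \is 2.-homog /\ forall v, ~ singular_at G v.

Definition transversal (k : fieldType) (G H : {mpoly k[3]}) :=
  forall v, (curve G `&` curve H) v ->
    row_free (col_mx (gradient G v) (gradient H v)).

Definition irreducible_singular_quartic (k : fieldType) (F : {mpoly k[3]}) :=
  [/\ F \is 4.-homog, irreducible_mpoly F & exists v, singular_at F v].

Definition two_conics (k : fieldType) (F : {mpoly k[3]}) :=
  exists G H : {mpoly k[3]},
    [/\ smooth_conic G, smooth_conic H, transversal G H & F = G * H].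

Definition general_smooth_point (k : fieldType) (F : {mpoly k[3]})
    (z : 'rV[k]_3) :=
  [/\ curve F z, gradient F z != 0 &
    exists p q : 'rV[k]_3,
      [/\ p != 0, q != 0,
          [/\ proj_point p <> proj_point z, proj_point q <> proj_point z &
              proj_point p <> proj_point q] &
          line (gradient F z) `&` curve F =
            proj_point z `|` proj_point p `|` proj_point q]].

(* The elliptic curve w ^+ 2 = g(x), for a cubic g over K that need not be    *)
(* monic; its zero is the unique point at infinity.                           *)

Inductive ec_point (K : Type) : Type := ECzero | ECaff of K & K.
Arguments ECzero {K}.

Definition on_ec (K : fieldType) (g : {poly K}) : set (ec_point K) :=
  [set P | if P is ECaff x w then w ^+ 2 = g.[x] else True].

(* Chord-tangent addition. The line w = w1 + m * (x - x1) meets the cubic in  *)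
(* three points whose abscissas add up to (m ^+ 2 - g`_2) / g`_3.             *)
Definition ec_add (K : fieldType) (g : {poly K}) (P Q : ec_point K) :
    ec_point K :=
  match P, Q with
  | ECzero, _ => Q
  | _, ECzero => P
  | ECaff x1 w1, ECaff x2 w2 =>
    if (x1 == x2) && (w1 == - w2) then ECzero else
    let m := if x1 == x2 then (g^`()).[x1] / (w1 *+ 2)
             else (w2 - w1) / (x2 - x1) in
    let x3 := (m ^+ 2 - g`_2) / g`_3 - x1 - x2 in
    ECaff x3 (m * (x1 - x3) - w1)
  end.

(* The function field k(t) of the base of the pencil, with the inclusion of k *)

Notation ratfun k := {fraction {poly k}}.

Definition ratfunC (k : fieldType) : k -> ratfun k :=
  @FracField.tofrac {poly k} \o polyC.
HB.instance Definition _ (k : fieldType) :=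
  GRing.RMorphism.copy (@ratfunC k) (@FracField.tofrac {poly k} \o polyC).

Definition ratfunX (k : fieldType) : ratfun k := FracField.tofrac 'X.

(* A frame (z, a, b) parametrizes the pencil of lines through z: the line of  *)
(* parameter t is spanned by z and t *: a + b.                                *)

Definition is_frame (k : fieldType) (z a b : 'rV[k]_3) :=
  row_free (col_mx z (col_mx a b)).

Definition pencil_base (k : fieldType) (a b : 'rV[k]_3) : 'rV[ratfun k]_3 :=
  ratfunX k *: map_mx (@ratfunC k) a + map_mx (@ratfunC k) b.

(* F(x z + t a + b), the restriction of F to the generic line of the pencil,  *)
(* as a polynomial in x over k(t); it is a cubic when z is a smooth point of  *)
(* the curve F.                                                               *)
Definition pencil_cubic (k : fieldType) (F : {mpoly k[3]})
    (z a b : 'rV[k]_3) : {poly ratfun k} :=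
  mmap (polyC \o @ratfunC k)
       (fun i => ratfunC (z 0 i) *: 'X + (pencil_base a b 0 i)%:P) F.

(* The Mordell-Weil group of the surface S attached to (F, z), i.e. the       *)
(* k(t)-points of its generic fibre. The pull-back of the quartic to the blown*)
(* up plane is the branch curve (proper transforms of the quartic and of the  *)
(* first exceptional curve) plus twice the second exceptional curve, so the   *)
(* double cover adjoins a square root of F to the function field of the plane.*)
(* Hence its generic fibre over the pencil is w ^+ 2 = F(x z + t a + b), whose*)
(* point at infinity (x = oo) lies over z: this is the section O.             *)
Definition MW (k : fieldType) (F : {mpoly k[3]}) (z a b : 'rV[k]_3) :
  set (ec_point (ratfun k)) := on_ec (pencil_cubic F z a b).

Definition MWadd (k : fieldType) (F : {mpoly k[3]}) (z a b : 'rV[k]_3) :=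
  ec_add (pencil_cubic F z a b).

(* The map to the plane on the generic fibre: homogeneous coordinates over    *)
(* k(t) of the image of P.                                                    *)
Definition fbar_generic (k : fieldType) (z a b : 'rV[k]_3)
    (P : ec_point (ratfun k)) : 'rV[ratfun k]_3 :=
  if P is ECaff x _ then x *: map_mx (@ratfunC k) z + pencil_base a b
  else map_mx (@ratfunC k) z.

(* The image in the plane of the section of P: the section is proper, so its  *)
(* image is the Zariski closure of the k(t)-point fbar_generic P.             *)
Definition fbar (k : fieldType) (z a b : 'rV[k]_3) (P : ec_point (ratfun k)) :
    set 'rV[k]_3 :=
  [set v : 'rV[k]_3 | v != 0 /\
    forall (d : nat) (G : {mpoly k[3]}), G \is d.-homog ->
      mmap (@ratfunC k) (fbar_generic z a b P 0) G = 0 -> G.@[v 0] = 0].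

Definition line_section (k : fieldType) (F : {mpoly k[3]})
    (z a b : 'rV[k]_3) (P : ec_point (ratfun k)) :=
  MW F z a b P /\ exists2 l : 'rV[k]_3, l != 0 & fbar z a b P = line l.

Definition on_a_conic (k : fieldType) (A : set 'rV[k]_3) :=
  exists G : {mpoly k[3]}, [/\ G != 0, G \is 2.-homog & A `<=` curve G].

(* Main.v *)
Require Import Defs.
From mathcomp Require Import all_boot all_order all_algebra.
From mathcomp Require Import ring zify.
From mathcomp Require Import boolp.

(** Over the function field [K = k(t)] of the pencil of lines through [z], the
    generic fibre is [w^2 = g(x)] with [g(x) = F(x z + t a + b)]. As [z] lies on
    the quartic, [g = c1 x^3 + c2 x^2 + c3 x + c4], where [cj] is a polynomial in
    [t] of degree at most [j], and [c1 = 0] is the equation of the tangent line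
    at [z].

    A line-section is a point whose abscissa is a polynomial in [t] of degree at
    most 1 ([line_sectionP]). If [P1 + P2 + P3 = P4], then the four points [P1],
    [P2], [P3] and [-P4] lie on a parabola [be w = c1 x^2 + B x + C], obtained by
    multiplying the equations of the two chords used in the addition
    ([ec_add3_parabola]). Eliminating [w] gives the identity
    [(c1 x^2 + B x + C)^2 - be^2 g(x) = c1^2 (x - x1) (x - x2) (x - x3) (x - x4)],
    and [be <> 0] because [x1], [x2] and [x3] are distinct.

    Comparing coefficients, [2 B] satisfies a monic cubic equation over [k[t]];
    since [k[t]] is integrally closed, [B], [C] and [be] are polynomials in [t],
    of degrees at most 2, 3 and 1 ([parabola_bounds]). The identity is therefore
    one between homogeneous forms of degree 6 on the plane
    ([parabola_meets_forms]). On the tangent line [c1 = 0] it reads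
    [(B x + C)^2 = be^2 F]: if [be] did not vanish there, the quartic would cut
    on the tangent line, besides [z], a double point (or the whole line) instead
    of two distinct points ([tangent_not_square]). So [be] is a constant multiple
    of [c1] ([parabola_lead_const]).

    Dividing by [be], the parabola becomes [w = G] with [G] homogeneous of degree
    2 in the plane, and the identity becomes [G^2 - F = ga^2 L1 L2 L3 L4], with
    [Li] an equation of the line of the [i]-th section and [ga] a nonzero
    constant. Hence the conic [G = 0] contains every point of the quartic that
    lies on one of the four lines. *)

Set Implicit Arguments.
Unset Strict Implicit.
Unset Printing Implicit Defensive.

Import Order.TTheory GRing.Theory Num.Theory.
Local Open Scope ring_scope.
Local Open Scope classical_set_scope.

Local Notation "p %:F" := (@FracField.tofrac _ p).

(** * Chords and parabolas on a cubic [w^2 = g(x)] *)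

Lemma horner_cubic (K : fieldType) (g : {poly K}) (x : K) : (size g <= 4)%N ->
  g.[x] = g`_0 + g`_1 * x + g`_2 * x ^+ 2 + g`_3 * x ^+ 3.
Proof.
by move=> /horner_coef_wide->; rewrite !big_ord_recr big_ord0 /=; ring.
Qed.

Lemma horner_deriv_cubic (K : fieldType) (g : {poly K}) (x : K) :
  (size g <= 4)%N ->
  (g^`()).[x] = g`_1 + g`_2 * x *+ 2 + g`_3 * x ^+ 2 *+ 3.
Proof.
move=> sg; have sg' : (size g^`() <= 3)%N.
  by apply/leq_sizeP => j lej; rewrite coef_deriv nth_default ?mul0rn// (leq_trans sg).
rewrite (horner_coef_wide _ sg') !big_ord_recr big_ord0 /= !coef_deriv; ring.
Qed.

(** The equation [w = m x + l] of the chord (or tangent) through two points, and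
    the coefficients of [g - (m x + l)^2 = g`_3 (x - x1) (x - x2) (x - x3)]; the
    sum of the two points is the reflection of the third intersection. *)
Lemma ec_add_line (K : fieldType) (g : {poly K}) (x1 w1 x2 w2 x3 w3 : K) :
  (2 : K) != 0 -> (size g <= 4)%N -> g`_3 != 0 ->
  w1 ^+ 2 = g.[x1] -> w2 ^+ 2 = g.[x2] ->
  ec_add g (ECaff x1 w1) (ECaff x2 w2) = ECaff x3 w3 ->
  exists m l : K,
    [/\ w1 = m * x1 + l, w2 = m * x2 + l & w3 = - (m * x3 + l)] /\
    [/\ g`_2 = m ^+ 2 - g`_3 * (x1 + x2 + x3),
        g`_1 = 2 * m * l + g`_3 * (x1 * x2 + x1 * x3 + x2 * x3) &
        g`_0 = l ^+ 2 - g`_3 * (x1 * x2 * x3)].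
Proof.
move=> n2 sg g3; rewrite !horner_cubic//=.
case: ifP => // /negbT; rewrite negb_and => neq E1 E2 [].
set m := if _ then _ else _ => X3 W3.
have g2E : g`_2 = m ^+ 2 - g`_3 * (x1 + x2 + x3) by rewrite -X3; field.
exists m, (w1 - m * x1).
have w2E : w2 = m * x2 + (w1 - m * x1).
  rewrite /m; case: eqP => [e|/eqP ne]; last by field; rewrite subr_eq0 eq_sym.
  move: neq; rewrite e eqxx /=; move: E1; rewrite e -E2 => /eqP.
  by rewrite eqf_sqr => /orP[/eqP->|->]// _; ring.
have g1E : g`_1 = 2 * m * (w1 - m * x1) +
    g`_3 * (x1 * x2 + x1 * x3 + x2 * x3).
  case: (eqVneq x1 x2) => [e|ne].
    have nw : w1 != 0.
      apply/eqP => w0; move: neq E1; rewrite e eqxx /= -E2 w0 => nw2 /esym/eqP.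
      by rewrite expr0n /= sqrf_eq0 => /eqP w20; move: nw2; rewrite w20 oppr0 eqxx.
    have mE : m * (w1 *+ 2) = (g^`()).[x1].
      rewrite /m e eqxx mulfVK// -mulr_natl mulf_neq0//.
    move: mE; rewrite horner_deriv_cubic// g2E -e => mE.
    have -> : 2 * m * (w1 - m * x1) = m * (w1 *+ 2) - 2 * m ^+ 2 * x1 by ring.
    by rewrite mE; ring.
  have nz : x2 - x1 != 0 by rewrite subr_eq0 eq_sym.
  apply: (mulfI nz).
  have -> : (x2 - x1) * g`_1 = w2 ^+ 2 - w1 ^+ 2 - g`_2 * (x2 ^+ 2 - x1 ^+ 2)
       - g`_3 * (x2 ^+ 3 - x1 ^+ 3) by rewrite E1 E2; ring.
  by rewrite g2E w2E; ring.
have g0E : g`_0 = w1 ^+ 2 - g`_1 * x1 - g`_2 * x1 ^+ 2 - g`_3 * x1 ^+ 3.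
  by rewrite E1; ring.
split; split=> //; first by ring.
  by rewrite -W3 -X3; ring.
by rewrite g0E g1E g2E; ring.
Qed.

(** The parabola [b w = A x^2 + B x + C] meets the curve [w^2 = g(x)] in four
    points, counted with multiplicities, of abscissas [x1], [x2], [x3] and [x4].
    The ordinates are eliminated from this definition. *)
Definition parabola_meets (K : comNzRingType) (g : {poly K})
    (A B C b x1 x2 x3 x4 : K) :=
  (A%:P * 'X ^+ 2 + B%:P * 'X + C%:P) ^+ 2 - b%:P ^+ 2 * g =
  A%:P ^+ 2 * (('X - x1%:P) * ('X - x2%:P) * ('X - x3%:P) * ('X - x4%:P)).

Lemma cubicE (K : nzRingType) (g : {poly K}) : (size g <= 4)%N ->
  g = (g`_3)%:P * 'X ^+ 3 + (g`_2)%:P * 'X ^+ 2 + (g`_1)%:P * 'X + (g`_0)%:P.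
Proof.
move=> sg; apply/polyP => i; rewrite !coefD !coefCM !coefXn coefX coefC.
case: i => [|[|[|[|i]]]] /=; rewrite ?mulr1 ?mulr0 ?addr0 ?add0r//.
by rewrite nth_default// (leq_trans sg).
Qed.

(** [parabola_meets] coefficient by coefficient, in degrees 3, 2, 1 and 0. *)
Lemma parabola_meetsP (K : comNzRingType) (g : {poly K})
    (A B C b x1 x2 x3 x4 : K) : (size g <= 4)%N ->
  parabola_meets g A B C b x1 x2 x3 x4 <->
  [/\ 2 * A * B - b ^+ 2 * g`_3 + A ^+ 2 * (x1 + x2 + (x3 + x4)) = 0,
      B ^+ 2 + 2 * A * C - b ^+ 2 * g`_2 -
        A ^+ 2 * (x1 * x2 + (x1 + x2) * (x3 + x4) + x3 * x4) = 0,
      2 * B * C - b ^+ 2 * g`_1 +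
        A ^+ 2 * (x1 * x2 * (x3 + x4) + (x1 + x2) * (x3 * x4)) = 0 &
      C ^+ 2 - b ^+ 2 * g`_0 - A ^+ 2 * (x1 * x2 * (x3 * x4)) = 0].
Proof.
move=> sg; rewrite /parabola_meets.
set d3 := _ + A ^+ 2 * (_ + (x3 + x4)); set d2 := _ - A ^+ 2 * (_ + x3 * x4).
set d1 := _ + A ^+ 2 * (_ + (x1 + x2) * (x3 * x4)); set d0 := C ^+ 2 - _ - _.
set l := (X in X = _); set r := (X in _ = X).
have E : l - r = d3%:P * 'X ^+ 3 + d2%:P * 'X ^+ 2 + d1%:P * 'X + d0%:P.
  rewrite /l [g in b%:P ^+ 2 * g]cubicE// /r /d3 /d2 /d1 /d0.
  rewrite !(polyCD, polyCN, polyCM, polyC_exp, polyC1).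
  by ring.
split=> [lr|[d3E d2E d1E d0E]].
  have c i := congr1 (fun p : {poly K} => p`_i) E.
  rewrite lr subrr in c; split.
  - by have := c 3; rewrite !coefD !coefCM !coefXn coefX coefC /= coef0 mulr1 !mulr0 !addr0.
  - by have := c 2; rewrite !coefD !coefCM !coefXn coefX coefC /= coef0 mulr1 !mulr0 !addr0 add0r.
  - by have := c 1; rewrite !coefD !coefCM !coefXn coefX coefC /= coef0 mulr1 !mulr0 !addr0 !add0r.
  - by have := c 0; rewrite !coefD !coefCM !coefXn coefX coefC /= coef0 !mulr0 !add0r.
by apply/eqP; rewrite -subr_eq0 E d3E d2E d1E d0E !mul0r !addr0.
Qed.

(** If [P1 + P2 + P3 = P4], then [P1], [P2], [P3] and [-P4] lie on a parabola. The
    chords [w = m x + l] through [P1], [P2] and [w = n x + k] through [P1 + P2],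
    [P3] satisfy [(w - m x - l) (w - n x - k) =
    (x - p) (g`_3 x^2 + B x + C - (m + n) w)] on the curve, where [p] is the
    abscissa of [P1 + P2]. *)
Lemma ec_add3_parabola (K : fieldType) (g : {poly K})
    (x1 w1 x2 w2 x3 w3 x4 w4 : K) :
  (2 : K) != 0 -> (size g <= 4)%N -> g`_3 != 0 ->
  w1 ^+ 2 = g.[x1] -> w2 ^+ 2 = g.[x2] -> w3 ^+ 2 = g.[x3] ->
  x1 != x2 -> x1 != x3 -> x2 != x3 ->
  ec_add g (ec_add g (ECaff x1 w1) (ECaff x2 w2)) (ECaff x3 w3) =
    ECaff x4 w4 ->
  exists be B C : K, be != 0 /\
    parabola_meets g g`_3 B C be x1 x2 x3 x4.
Proof.
move=> n2 sg g3 E1 E2 E3 n12 n13 n23.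
case E12 : (ec_add g (ECaff x1 w1) _) => [|p w].
  by move: E12; rewrite /= (negbTE n12).
have [m [l [[_ _ wE] [e2 e1 e0]]]] := ec_add_line n2 sg g3 E1 E2 E12.
have Ep : w ^+ 2 = g.[p] by rewrite wE horner_cubic// e2 e1 e0; ring.
move=> E34.
have [n [k [[w'E _ _] [e2' e1' e0']]]] := ec_add_line n2 sg g3 Ep E3 E34.
have kE : k = - (m + n) * p - l.
  have -> : k = w - n * p by rewrite w'E; ring.
  by rewrite wE; ring.
pose B := g`_2 + m * n + g`_3 * p.
pose C := g`_1 + m * k + n * l + B * p.
have hS : g`_3 * (x3 + x4) = n ^+ 2 - m ^+ 2 + g`_3 * (x1 + x2).
  have -> : n ^+ 2 = g`_2 + g`_3 * (p + x3 + x4) by rewrite e2'; ring.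
  by rewrite e2; ring.
have hP : g`_3 * (x3 * x4) = 2 * m * l + g`_3 * (x1 * x2 + x1 * p + x2 * p)
     - 2 * n * k - g`_3 * (x3 + x4) * p.
  by rewrite -e1 e1'; ring.
rewrite hS in hP.
have meets : parabola_meets g g`_3 B C (m + n) x1 x2 x3 x4.
  apply/(parabola_meetsP _ _ _ _ _ _ _ _ sg); split.
  - have -> : g`_3 ^+ 2 * (x1 + x2 + (x3 + x4)) =
      g`_3 * (g`_3 * (x1 + x2) + g`_3 * (x3 + x4)) by ring.
    by rewrite hS /B e2; ring.
  - have -> : g`_3 ^+ 2 * (x1 * x2 + (x1 + x2) * (x3 + x4) + x3 * x4) =
      g`_3 * (g`_3 * (x1 * x2) + (x1 + x2) * (g`_3 * (x3 + x4)) +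
      g`_3 * (x3 * x4)) by ring.
    by rewrite hP hS /C /B e1 e2 kE; ring.
  - have -> : g`_3 ^+ 2 * (x1 * x2 * (x3 + x4) + (x1 + x2) * (x3 * x4)) =
      g`_3 * ((x1 * x2) * (g`_3 * (x3 + x4)) + (x1 + x2) * (g`_3 * (x3 * x4))).
      by ring.
    by rewrite hP hS /C /B e1 e2 kE; ring.
  - have -> : g`_3 ^+ 2 * (x1 * x2 * (x3 * x4)) =
      g`_3 * (x1 * x2) * (g`_3 * (x3 * x4)) by ring.
    by rewrite hP /C /B e0 e1 e2 kE; ring.
exists (m + n), B, C; split=> //; apply/eqP => b0; move: meets.
rewrite /parabola_meets b0 polyC0 expr0n mul0r subr0 => meets.
clearbody C B.
(* A quadratic polynomial [v] would vanish at [x1], [x2] and [x3]. *)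
pose v y := g`_3 * y ^+ 2 + B * y + C.
have vE y : v y ^+ 2 =
    g`_3 ^+ 2 * ((y - x1) * (y - x2) * (y - x3) * (y - x4)).
  have := congr1 (horner^~ y) meets; rewrite /= !hornerE /= => E.
  transitivity ((g`_3 * y * y + B * y + C) ^+ 2); first by rewrite /v; ring.
  by rewrite E; ring.
have r1 : v x1 = 0 by apply/eqP; rewrite -sqrf_eq0 vE; apply/eqP; ring.
have r2 : v x2 = 0 by apply/eqP; rewrite -sqrf_eq0 vE; apply/eqP; ring.
have r3 : v x3 = 0 by apply/eqP; rewrite -sqrf_eq0 vE; apply/eqP; ring.
have a12 : g`_3 * (x1 + x2) + B = 0.
  apply: (@mulfI _ (x1 - x2)); first by rewrite subr_eq0.
  rewrite mulr0; transitivity (v x1 - v x2); last by rewrite r1 r2 subrr.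
  by rewrite /v; ring.
have a13 : g`_3 * (x1 + x3) + B = 0.
  apply: (@mulfI _ (x1 - x3)); first by rewrite subr_eq0.
  rewrite mulr0; transitivity (v x1 - v x3); last by rewrite r1 r3 subrr.
  by rewrite /v; ring.
move/eqP: n23; apply; apply: (mulfI g3).
by apply: (addrI (g`_3 * x1 + B)); rewrite addrAC -mulrDr a12 addrAC -mulrDr a13.
Qed.

(** * Polynomials inside the field of rational functions *)

Lemma ratfun_coprime (k : fieldType) (f : ratfun k) :
  exists p q : {poly k}, [/\ q != 0, coprimep p q & f * q%:F = p%:F].
Proof.
have [p [q [q0 fE]]] : exists p q : {poly k}, q != 0 /\ f * q%:F = p%:F.
  elim/quotW: f => r; exists r.1, r.2; split; first exact: denom_ratioP.
  unlock FracField.tofrac.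
  rewrite -[LHS]FracField.pi_mul; apply/eqmodP; rewrite /= FracField.equivfE.
  rewrite /FracField.mulf !numden_Ratio ?mulf_neq0 ?oner_eq0 ?denom_ratioP//.
  by rewrite !mulr1 mulrC.
pose d := gcdp p q.
have d0 : d != 0 by rewrite gcdp_eq0 negb_and q0 orbT.
exists (p %/ d), (q %/ d); split.
- by rewrite dvdp_div_eq0 ?dvdp_gcdr.
- by apply: coprimep_div_gcd; rewrite q0 orbT.
have dF0 : d%:F != 0 by rewrite tofrac_eq0.
apply: (mulIf dF0); rewrite -mulrA -!tofracM !divpK ?dvdp_gcdl ?dvdp_gcdr//.
Qed.

(** [f] is a polynomial in [t] with at most [n] coefficients, i.e. of degree
    less than [n]; in particular [f = 0] when [n = 0]. *)
Definition polyfrac (k : fieldType) (n : nat) (f : ratfun k) :=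
  exists2 p : {poly k}, f = p%:F & (size p <= n)%N.

Section Polyfrac.
Variable k : fieldType.
Implicit Types f g : ratfun k.

Lemma polyfrac_widen m n f : (m <= n)%N -> polyfrac m f -> polyfrac n f.
Proof. by move=> mn [p -> sp]; exists p => //; apply: leq_trans mn. Qed.

Lemma polyfrac0 n : polyfrac n (0 : ratfun k).
Proof. by exists 0; rewrite ?tofrac0 ?size_poly0. Qed.

Lemma polyfracC c : polyfrac 1 (ratfunC c : ratfun k).
Proof. by exists c%:P => //; rewrite size_polyC leq_b1. Qed.

Lemma polyfracX : polyfrac 2 (ratfunX k).
Proof. by exists 'X => //; rewrite size_polyX. Qed.

Lemma polyfracD n f g : polyfrac n f -> polyfrac n g -> polyfrac n (f + g).
Proof.
move=> [p -> sp] [q -> sq]; exists (p + q); first by rewrite tofracD.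
by rewrite (leq_trans (size_polyD _ _))// geq_max sp.
Qed.

Lemma polyfracN n f : polyfrac n f -> polyfrac n (- f).
Proof. by move=> [p -> sp]; exists (- p); rewrite ?tofracN ?size_polyN. Qed.

Lemma polyfracB n f g : polyfrac n f -> polyfrac n g -> polyfrac n (f - g).
Proof. by move=> hf hg; apply/polyfracD/polyfracN. Qed.

Lemma polyfracM m n f g :
  polyfrac m f -> polyfrac n g -> polyfrac (m + n).-1 (f * g).
Proof.
move=> [p -> sp] [q -> sq]; exists (p * q); first by rewrite tofracM.
by rewrite (leq_trans (size_polyMleq _ _))// -!subn1 leq_sub2r// leq_add.
Qed.

Lemma polyfracZ n c f : polyfrac n f -> polyfrac n (ratfunC c * f).
Proof. by move=> hf; have := polyfracM (polyfracC c) hf. Qed.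

(** [k[t]] is integrally closed in [k(t)], with control of the degree: an
    element that satisfies a monic equation of degree [d] whose [i]-th
    coefficient has degree at most [N * (d - i)] has degree at most [N]. *)
Lemma polyfrac_integral d N (a : 'I_d -> ratfun k) f : (0 < d)%N ->
  (forall i : 'I_d, polyfrac (N * (d - i)).+1 (a i)) ->
  f ^+ d = \sum_(i < d) a i * f ^+ i -> polyfrac N.+1 f.
Proof.
move=> d0 ha fE.
have /fin_all_exists2[b bE sb] (i : 'I_d) : exists2 p : {poly k}, a i = p%:F &
  (size p <= (N * (d - i)).+1)%N by have [p] := ha i; exists p.
have [p [q [q0 cpq pqE]]] := ratfun_coprime f.
(* The denominator divides a power of the numerator, hence is a unit. *)
have qp : q %| p ^+ d.
  have -> : p ^+ d = \sum_(i < d) b i * p ^+ i * q ^+ (d - i).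
    apply/eqP; rewrite -tofrac_eq tofracXn -pqE exprMn fE mulr_suml.
    rewrite rmorph_sum /=; apply/eqP; apply: eq_bigr => i _.
    rewrite !tofracM !tofracXn -pqE bE exprMn -!mulrA -exprD.
    by rewrite subnKC// ltnW.
  elim/big_ind: _ => [|x y|i _]; [exact: dvdp0 | exact: dvdp_add |].
  by rewrite dvdp_mull// dvdp_exp// subn_gt0.
have {qp} : size q == 1.
  move: qp; rewrite -[p ^+ d]mulr1 Gauss_dvdpr ?coprimep_expr// 1?coprimep_sym//.
  by rewrite dvdp1.
case/size_poly1P=> c c0 qE.
have fp : f = (c^-1 *: p)%:F.
  apply: (@mulIf _ q%:F); first by rewrite tofrac_eq0.
  by rewrite pqE -tofracM qE mulrC mul_polyC scalerA divff// scale1r.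
exists (c^-1 *: p) => //; move: (_ *: _) fp => {p q q0 cpq pqE c c0 qE} p fp.
have pE : p ^+ d = \sum_(i < d) b i * p ^+ i.
  apply/eqP; rewrite -tofrac_eq tofracXn -fp fE rmorph_sum /=; apply/eqP.
  by apply: eq_bigr => i _; rewrite tofracM tofracXn -fp bE.
(* If [p] had degree more than [N], then [p ^+ d] would have a larger degree than
   every other term of the equation. *)
rewrite leqNgt; apply/negP => sp.
have p0 : p != 0 by rewrite -size_poly_gt0 (leq_trans _ sp).
have spE n : size (p ^+ n) = ((size p).-1 * n).+1.
  by rewrite -size_exp prednK// size_poly_gt0 expf_neq0.
suff: (size (\sum_(i < d) b i * p ^+ i)%R < size (p ^+ d)%R)%N by rewrite -pE ltnn.
rewrite spE.
apply: (@leq_ltn_trans (\max_(i < d) size (b i * p ^+ i)%R) _ _ (size_sum _ _ _)).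
rewrite ltnS; apply/bigmax_leqP => i _.
apply: leq_trans (size_polyMleq _ _) _; rewrite spE addnS /=.
move: (sb i) sp (ltn_ord i); move: (size (b i)) (size p) => u v.
move: (nat_of_ord i) => {}i su sv ij.
have : (N * (d - i) < v.-1 * (d - i))%N by rewrite ltn_mul2r; lia.
have : (v.-1 * d = v.-1 * i + v.-1 * (d - i))%N by rewrite -mulnDr subnKC// ltnW.
lia.
Qed.

End Polyfrac.

(** * Evaluation of homogeneous polynomials *)

(** Induction on homogeneous polynomials: a property of pairs (degree,
    polynomial) holds as soon as it is linear in each degree, holds for 1 and is
    stable under multiplication by a variable. *)
Lemma dhomog_ind (n : nat) (k : fieldType) (P : nat -> {mpoly k[n]} -> Prop) :
  P 0 1 -> (forall d p i, P d p -> P d.+1 (p * 'X_i)) ->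
  (forall d, P d 0) ->
  (forall d c p q, P d p -> P d q -> P d (c *: p + q)) ->
  forall d p, p \is d.-homog -> P d p.
Proof.
move=> P1 PX P0 PD d p /dhomog_mf hp.
have PM e m : mdeg m = e -> P e 'X_[m].
  elim: e m => [|e IH] m me.
    by move/eqP: me; rewrite mdeg_eq0 => /eqP->; rewrite mpolyX0.
  have [i mi] : exists i, m i != 0.
    apply/existsP; rewrite -negb_forall; apply/negP => /forallP m0.
    suff m00 : m = 0%MM by rewrite m00 mdeg0 in me.
    by apply/mnmP => i; rewrite mnm0E; apply/eqP/m0.
  have im : (U_(i) <= m)%MM by rewrite lep1mP.
  rewrite -(submK im) mpolyXD; apply/PX/IH/eqP.
  by rewrite -(eqn_add2r (mdeg U_(i))) -mdegD submK// mdeg1 me addn1.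
rewrite [p]mpolyE big_seq; elim/big_ind: _ => // [x y Px Py|m mp].
  by rewrite -[x]scale1r; apply: PD.
by rewrite -[_ *: _]addr0; apply/PD => //; apply/PM; rewrite -(hp _ mp).
Qed.

Lemma mmap_ext (n : nat) (k : fieldType) (A : comNzRingType)
    (f g : k -> A) (h h' : 'I_n -> A) p :
  f =1 g -> h =1 h' -> mmap f h p = mmap g h' p.
Proof.
move=> fg hh; apply: eq_bigr => m _; rewrite fg; congr (_ * _).
by apply: eq_bigr => i _; rewrite hh.
Qed.

Lemma rmorph_mmap (n : nat) (k : fieldType) (A B : comNzRingType)
    (phi : {rmorphism A -> B}) (f : k -> A) (h : 'I_n -> A) p :
  phi (mmap f h p) = mmap (phi \o f) (phi \o h) p.
Proof.
rewrite rmorph_sum; apply: eq_bigr => m _; rewrite rmorphM rmorph_prod.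
by congr (_ * _); apply: eq_bigr => i _; rewrite rmorphXn.
Qed.

Lemma mmap_scale (n : nat) (k : fieldType) (A : comNzRingType)
    (f : {rmorphism k -> A}) (h : 'I_n -> A) (c : A) d p :
  p \is d.-homog -> mmap f (fun i => c * h i) p = c ^+ d * mmap f h p.
Proof.
move: d p; apply: dhomog_ind => [|d p i IH|d|d e p q IHp IHq].
- by rewrite !rmorph1 expr0 mulr1.
- by rewrite !rmorphM /= !mmapX !mmap1U IH exprSr mulrACA.
- by rewrite !rmorph0 mulr0.
- by rewrite !mmapD !mmapZ IHp IHq mulrDr mulrCA.
Qed.

Section Meval.
Variables (n : nat) (k : numFieldType).
Implicit Types D G : {mpoly k[n]}.

Lemma meval_scale D d c (v : 'I_n -> k) :
  D \is d.-homog -> D.@[fun i => c * v i] = c ^+ d * D.@[v].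
Proof. exact: mmap_scale. Qed.

Lemma mmap_polyC_horner D (h : 'I_n -> {poly k}) (x : k) :
  (mmap polyC h D).[x] = D.@[fun i => (h i).[x]].
Proof.
rewrite -horner_evalE rmorph_mmap; apply: mmap_ext => // c /=.
by rewrite horner_evalE hornerC.
Qed.

Lemma mmap_ratfunC_tofrac D (h : 'I_n -> {poly k}) :
  mmap (@ratfunC k) (fun i => (h i)%:F) D = (mmap polyC h D)%:F.
Proof. by rewrite rmorph_mmap. Qed.

End Meval.

Lemma poly_infinite_roots (k : numFieldType) (p : {poly k}) :
  (forall x, x != 0 -> p.[x] = 0) -> p = 0.
Proof.
move=> p0; apply/eqP/negPn/negP => pn0.
have := max_poly_roots (rs := [seq (i.+1%:R : k) | i <- iota 0 (size p)]) pn0.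
rewrite size_map size_iota ltnn => h; apply/negP: isT; apply: h.
  by apply/allP => _ /mapP[i _ ->]; apply/rootP/p0; rewrite pnatr_eq0.
rewrite map_inj_uniq ?iota_uniq// => i j /eqP.
by rewrite eqr_nat => /eqP[].
Qed.

(** * Coordinates attached to a frame *)

(** The value at [v] of the linear form with coefficients [f]. *)
Definition lin_eval (k : fieldType) (f : 'cV[k]_3) (v : 'rV[k]_3) : k :=
  (v *m f) 0 0.

(** The linear form with coefficients [f], as a polynomial. *)
Definition lin_form (k : fieldType) (f : 'cV[k]_3) : {mpoly k[3]} :=
  \sum_i f i 0 *: 'X_i.

(** [fx], [fs] and [fu] are the coordinates in the basis [(z, a, b)]. The generic
    line of the pencil consists of the points with [fs = t * fu]. *)
Definition dual_frame (k : fieldType) (z a b : 'rV[k]_3)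
    (fx fs fu : 'cV[k]_3) :=
  (forall v, v = lin_eval fx v *: z + lin_eval fs v *: a + lin_eval fu v *: b)
  /\ (forall X S U, [/\ lin_eval fx (X *: z + S *: a + U *: b) = X,
        lin_eval fs (X *: z + S *: a + U *: b) = S &
        lin_eval fu (X *: z + S *: a + U *: b) = U]).

Section LinForm.
Variable k : fieldType.
Implicit Types (f : 'cV[k]_3) (u v z a b : 'rV[k]_3).

Lemma lin_evalD f u v : lin_eval f (u + v) = lin_eval f u + lin_eval f v.
Proof. by rewrite /lin_eval mulmxDl mxE. Qed.

Lemma lin_evalZ f c v : lin_eval f (c *: v) = c * lin_eval f v.
Proof. by rewrite /lin_eval -scalemxAl mxE. Qed.

Lemma lin_evalE f v : lin_eval f v = \sum_i v 0 i * f i 0.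
Proof. by rewrite /lin_eval mxE. Qed.

Lemma meval_lin_form f v : (lin_form f).@[v 0] = lin_eval f v.
Proof.
rewrite /meval raddf_sum /= lin_evalE; apply: eq_bigr => i _.
by rewrite mmapZ mmapX mmap1U mulrC.
Qed.

Lemma lin_form_homog f : lin_form f \is 1.-homog.
Proof. by apply: rpred_sum => i _; apply: dhomogZ; rewrite dhomogX /= mdeg1. Qed.

Lemma frame_dual z a b : is_frame z a b ->
  exists fx fs fu, dual_frame z a b fx fs fu.
Proof.
move=> fr; pose M : 'M[k]_3 := col_mx z (col_mx a b).
have Mu : M \in unitmx by rewrite -row_free_unit.
pose W : 'M[k]_(3, 1 + (1 + 1)) := invmx M.
have MW : col_mx z (col_mx a b) *m W = 1%:M by apply: (mulmxV Mu).
have WM : W *m col_mx z (col_mx a b) = 1%:M by apply: (mulVmx Mu).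
exists (lsubmx W), (lsubmx (rsubmx W)), (rsubmx (rsubmx W)).
have : W = row_mx (lsubmx W) (row_mx (lsubmx (rsubmx W)) (rsubmx (rsubmx W))).
  by rewrite !hsubmxK.
move: (lsubmx W) (lsubmx (rsubmx W)) (rsubmx (rsubmx W)) => fx fs fu WE.
move: WM MW; rewrite {}WE !mul_row_col => dec.
rewrite mul_col_row mul_mx_row mul_col_mx mul_col_row.
rewrite scalar_mx_block => /eq_block_mx[zx]; rewrite -row_mx0 => /eq_row_mx[zs zu].
rewrite -[X in _ = X -> _]vsubmxK => /eq_col_mx[ax bx].
rewrite scalar_mx_block => /eq_block_mx[as_ au bs bu].
split=> [v|X S U].
  rewrite -{1}[v]mulmx1 -dec !mulmxDr !mulmxA addrA.
  by rewrite [v *m fx]mx11_scalar [v *m fs]mx11_scalar [v *m fu]mx11_scalar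
     !mul_scalar_mx.
rewrite /lin_eval !mulmxDl -!scalemxAl zx zs zu ax bx as_ au bs bu.
split; rewrite !mxE /= ?mulr1 ?mulr0 ?addr0 ?add0r//.
Qed.

End LinForm.

(** * Forms on the plane and their restriction to the generic line *)

Lemma scale_linear_poly (A B : comNzRingType) (phi : {rmorphism A -> B})
    (f z a b : A) (t : B) :
  (phi f)%:P * (phi z *: 'X + (t * phi a + phi b)%:P) =
  phi (z * f) *: 'X + (t * phi (a * f) + phi (b * f))%:P.
Proof. by rewrite !rmorphM !polyCD -!mul_polyC !polyCM; ring. Qed.

Lemma dual_polys (A : comNzRingType) (t : A) :
  [/\ 1 *: 'X + (t * 0 + 0)%:P = 'X, 0 *: 'X + (t * 1 + 0)%:P = t%:P &
      0 *: 'X + (t * 0 + 1)%:P = 1].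
Proof. by rewrite !mulr0 mulr1 !add0r addr0 scale1r !scale0r !add0r addr0. Qed.

Lemma polyC_monomial (A : comNzRingType) (c t : A) i j :
  c%:P * (t%:P ^+ i * 1 ^+ j) = (c * t ^+ i)%:P.
Proof. by rewrite expr1n mulr1 polyCM polyC_exp. Qed.

Section Pencil.
Variables (k : numFieldType) (z a b : 'rV[k]_3).
Implicit Types (f : 'cV[k]_3) (u v : 'rV[k]_3) (D : {mpoly k[3]}).

Lemma pencil_lin_form f : pencil_cubic (lin_form f) z a b =
  ratfunC (lin_eval f z) *: 'X +
  (ratfunX k * ratfunC (lin_eval f a) + ratfunC (lin_eval f b))%:P.
Proof.
rewrite /pencil_cubic raddf_sum /= !lin_evalE !rmorph_sum /=.
rewrite mulr_sumr -big_split scaler_suml rmorph_sum -big_split /=.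
apply: eq_bigr => i _; rewrite mmapZ mmapX mmap1U /= !mxE.
exact: (scale_linear_poly (@ratfunC k)).
Qed.

(** A form that vanishes identically on the generic line of the pencil vanishes
    at every point of the plane. *)
Lemma pencil_eq0 D d : is_frame z a b -> D \is d.-homog ->
  pencil_cubic D z a b = 0 -> forall v, D.@[v 0] = 0.
Proof.
move=> fr hD D0 v; have [fx [fs [fu [dec _]]]] := frame_dual fr; rewrite [v]dec.
move: (lin_eval fx v) (lin_eval fs v) (lin_eval fu v) => X S U.
have aff x s : D.@[(x *: z + s *: a + b) 0] = 0.
  pose h (i : 'I_3) : {poly k} := 
    (z 0 i)%:P * x%:P + ('X * (a 0 i)%:P + (b 0 i)%:P).
  have /eqP : mmap polyC h D = 0.
    apply/eqP; rewrite -tofrac_eq0 -mmap_ratfunC_tofrac.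
    move/(congr1 (horner_eval (ratfunC x))): D0; rewrite rmorph0 rmorph_mmap.
    move=> E; apply/eqP; rewrite -[RHS]E; apply: mmap_ext => [c|i] /=.
      by rewrite horner_evalE hornerC.
    rewrite horner_evalE hornerD hornerZ hornerX hornerC !mxE.
    by rewrite /h tofracD tofracM tofracD tofracM.
  move=> /eqP E; have := congr1 (fun p : {poly k} => p.[s]) E.
  rewrite horner0 mmap_polyC_horner => <-; apply: meval_eq => i.
  by rewrite /h !mxE !hornerE /=; ring.
have nz Y T c : c != 0 -> D.@[(Y *: z + T *: a + c *: b) 0] = 0.
  move=> c0; rewrite -[RHS](mulr0 (c ^+ d)) -(aff (Y / c) (T / c)).
  rewrite -(meval_scale _ _ hD); apply: meval_eq => i.
  by rewrite !mxE; field.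
have [->|/nz->//] := eqVneq U 0.
(* The value at [U] is a polynomial in [U] that vanishes for [U != 0]. *)
pose h (i : 'I_3) : {poly k} := (X * z 0 i + S * a 0 i)%:P + (b 0 i) *: 'X.
have hE c : (mmap polyC h D).[c] = D.@[(X *: z + S *: a + c *: b) 0].
  rewrite mmap_polyC_horner; apply: meval_eq => i.
  by rewrite /h !mxE !hornerE /=; ring.
have h0 : mmap polyC h D = 0.
  by apply: poly_infinite_roots => c /nz; rewrite hE.
by rewrite -[LHS](hE 0) h0 horner0.
Qed.

Variables (fx fs fu : 'cV[k]_3).
Hypothesis df : dual_frame z a b fx fs fu.

Lemma dual_frame_z : [/\ lin_eval fx z = 1, lin_eval fs z = 0 & lin_eval fu z = 0].
Proof. by have := df.2 1 0 0; rewrite scale1r !scale0r !addr0. Qed.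

Lemma dual_frame_a : [/\ lin_eval fx a = 0, lin_eval fs a = 1 & lin_eval fu a = 0].
Proof. by have := df.2 0 1 0; rewrite scale1r !scale0r !addr0 add0r. Qed.

Lemma dual_frame_b : [/\ lin_eval fx b = 0, lin_eval fs b = 0 & lin_eval fu b = 1].
Proof. by have := df.2 0 0 1; rewrite scale1r !scale0r !add0r. Qed.

(** On the generic line, [fx], [fs] and [fu] restrict to [x], [t] and 1. *)
Lemma pencil_dual : [/\ pencil_cubic (lin_form fx) z a b = 'X,
  pencil_cubic (lin_form fs) z a b = (ratfunX k)%:P &
  pencil_cubic (lin_form fu) z a b = 1].
Proof.
rewrite !pencil_lin_form; case: dual_frame_z => -> -> ->.
case: dual_frame_a => -> -> ->; case: dual_frame_b => -> -> ->.
have r0 : ratfunC 0 = 0 :> ratfun k by exact: (rmorph0 (@ratfunC k)).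
have r1 : ratfunC 1 = 1 :> ratfun k by exact: (rmorph1 (@ratfunC k)).
by rewrite r0 r1; exact: dual_polys.
Qed.

(** The binary form of degree [n] in the coordinates [fs] and [fu] that
    dehomogenizes to [p]. *)
Definition binary_form n (p : {poly k}) : {mpoly k[3]} :=
  \sum_(i < n.+1) p`_i *: (lin_form fs ^+ i * lin_form fu ^+ (n - i)).

Lemma binary_form_homog n p : binary_form n p \is n.-homog.
Proof.
apply: rpred_sum => i _; apply: dhomogZ.
have := dhomogM (dhomogMn i (lin_form_homog fs)) (dhomogMn (n - i) (lin_form_homog fu)).
by rewrite !mul1n subnKC// -ltnS.
Qed.

Lemma pencil_binary_form n (p : {poly k}) : (size p <= n.+1)%N ->
  pencil_cubic (binary_form n p) z a b = (p%:F)%:P.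
Proof.
move=> sp.
have pE : p%:F = \sum_(i < n.+1) ratfunC p`_i * ratfunX k ^+ i.
  have {1}-> : p = \sum_(i < n.+1) (p`_i)%:P * 'X ^+ i.
    rewrite -[LHS]coefK poly_def (big_ord_widen n.+1 (fun i : nat => p`_i *: 'X^i))//.
    rewrite big_mkcond; apply: eq_bigr => i _ /=; rewrite mul_polyC.
    by case: ltnP => // ni; rewrite nth_default// scale0r.
  rewrite rmorph_sum /=; apply: eq_bigr => i _.
  by rewrite tofracM tofracXn.
rewrite pE /pencil_cubic raddf_sum /= rmorph_sum /=; apply: eq_bigr => i _.
rewrite mmapZ rmorphM !rmorphXn /=.
case: pencil_dual => _; rewrite /pencil_cubic => -> ->.
exact: polyC_monomial.
Qed.

Lemma meval_binary_form n p v : (binary_form n p).@[v 0] =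
  \sum_(i < n.+1) p`_i * (lin_eval fs v ^+ i * lin_eval fu v ^+ (n - i)).
Proof.
rewrite raddf_sum /=; apply: eq_bigr => i _.
by rewrite mevalZ mevalM !rmorphXn /= !meval_lin_form.
Qed.

End Pencil.

(** * Coefficients of the restriction to the generic line *)

(** The two highest coefficients of [D(x z + y)] are [D(z)] and the derivative of
    [D] at [z] along [y]. The second one is read on [x * D(x z + y)], so that it
    makes sense for [d = 0]. *)
Lemma mmap_line_top_coef (n : nat) (k : fieldType) (A : comNzRingType)
    (phi : {rmorphism k -> A}) (z : 'I_n -> k) (y : 'I_n -> A) d D :
  D \is d.-homog ->
  let p := mmap (polyC \o phi) (fun i => phi (z i) *: 'X + (y i)%:P) D in
  [/\ (size p <= d.+1)%N, p`_d = phi D.@[z] &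
      ('X * p)`_d = \sum_i phi (mderiv i D).@[z] * y i].
Proof.
move: d D; apply: dhomog_ind => [|d D i [sp p0 p1]|d|d c D E' [sp p0 p1] [sq q0 q1]] /=.
- rewrite !rmorph1 size_poly1 coefC mulr1 coefX; split=> //=.
  rewrite big1// => i _.
  by rewrite -mpolyC1 mderivC rmorph0 rmorph0 mul0r.
- rewrite rmorphM /= mmapX mmap1U.
  move: (mmap _ _ _) sp p0 p1 => p sp p0 p1.
  rewrite mulrDr -scalerAr; split.
  + rewrite (leq_trans (size_polyD _ _))// geq_max.
    apply/andP; split; first apply: leq_trans (size_scale_leq _ _) _.
      by apply: leq_trans (size_polyMleq _ _) _; rewrite size_polyX addn2 ltnS.
    apply: leq_trans (size_polyMleq _ _) _.
    apply: (@leq_trans (d.+1 + 1).-1); last by rewrite addn1.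
    by rewrite -!subn1 leq_sub2r// leq_add// size_polyC_leq1.
  + rewrite coefD coefZ coefMX coefMC /= p0 (_ : p`_d.+1 = 0) ?nth_default//.
    by rewrite mul0r addr0 rmorphM /= mevalXU rmorphM mulrC.
  + rewrite mulrDr -scalerAr !mulrA coefD coefZ coefMX coefMC /= p1 coefXM /= p0.
    rewrite mulr_sumr.
    under [RHS]eq_bigr => j _ do
      rewrite mderivM rmorphD !rmorphM /= mevalXU rmorphD !rmorphM mulrDl.
    rewrite big_split /=; congr (_ + _).
      by apply: eq_bigr => j _; rewrite mulrC mulrAC.
    rewrite (bigD1 i)//= big1 ?addr0.
      rewrite mderivX mnm1E eqxx scale1r (_ : (U_(i) - U_(i))%MM = 0%MM).
        by rewrite mpolyX0 !rmorph1 mulr1.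
      by apply/mnmP => j; rewrite mnmBE subnn mnm0E.
    move=> j ji; rewrite mderivX mnm1E eq_sym (negbTE ji) scale0r !rmorph0.
    by rewrite mulr0 mul0r.
- rewrite !rmorph0 size_poly0 mulr0 coef0; split=> //.
  by rewrite big1// => i _; rewrite mderiv0 !rmorph0 mul0r.
- rewrite mmapD mmapZ; split.
  + rewrite (leq_trans (size_polyD _ _))// geq_max sq andbT /= mul_polyC.
    by rewrite (leq_trans (size_scale_leq _ _)).
  + by rewrite coefD coefCM p0 q0 mevalD mevalZ rmorphD rmorphM.
  + rewrite mulrDr mulrCA coefD coefCM p1 q1 mulr_sumr -big_split /=.
    apply: eq_bigr => i _; rewrite mderivD mderivZ mevalD mevalZ rmorphD rmorphM.
    by rewrite mulrDl mulrA.
Qed.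

Lemma mul_lin_rmorph (A B : comNzRingType) (phi : {rmorphism A -> B})
    (f a b : A) (t : B) :
  phi f * (t * phi a + phi b) = t * phi (a * f) + phi (b * f).
Proof. by rewrite !rmorphM; ring. Qed.

Section PencilCoef.
Variables (k : numFieldType) (z a b : 'rV[k]_3).

(** The coefficient of [x^j] in [D(x z + t a + b)] is a polynomial in [t] of degree
    at most [d - j]. *)
Lemma pencil_coef_polyfrac D d : D \is d.-homog ->
  forall j, polyfrac (d.+1 - j) (pencil_cubic D z a b)`_j.
Proof.
move: d D; apply: dhomog_ind => [j|d D i IH j|d j|d c p q IHp IHq j].
- rewrite /pencil_cubic rmorph1 coef1; case: j => [|j]; last exact: polyfrac0.
  by have := polyfracC (1 : k); rewrite (rmorph1 (@ratfunC k)).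
- rewrite /pencil_cubic rmorphM /= mmapX mmap1U.
  rewrite mulrDr -scalerAr coefD coefZ coefMX coefMC; apply: polyfracD.
    apply: polyfracZ; case: j => [|j]; first exact: polyfrac0.
    by rewrite subSS; apply: IH.
  have [jd|jd] := leqP j d.
    have pb : polyfrac 2 (pencil_base a b 0 i).
      rewrite !mxE; apply: polyfracD.
        exact: polyfracM (polyfracX k) (polyfracC _).
      exact: polyfrac_widen (polyfracC _).
    have := polyfracM (IH j) pb.
    by apply: polyfrac_widen; lia.
  have := IH j; rewrite (_ : d.+1 - j = 0)%N; last by lia.
  move=> [p pE]; rewrite leqn0 size_poly_eq0 => /eqP p0.
  rewrite -/(pencil_cubic D z a b) pE p0 tofrac0 mul0r; exact: polyfrac0.
- by rewrite /pencil_cubic rmorph0 coef0; apply: polyfrac0.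
- rewrite /pencil_cubic mmapD mmapZ coefD coefCM.
  by apply: polyfracD; [apply: polyfracZ; apply: IHp | apply: IHq].
Qed.

(** The coefficients of [F(x z + t a + b)] in the two highest powers of [x]. *)
Lemma pencil_top_coef D d : D \is d.-homog ->
  (pencil_cubic D z a b)`_d = ratfunC D.@[z 0] /\
  ('X * pencil_cubic D z a b)`_d =
    ratfunX k * ratfunC (lin_eval (gradient D z)^T a) +
    ratfunC (lin_eval (gradient D z)^T b).
Proof.
move=> hD.
have [_ ? E] := mmap_line_top_coef (@ratfunC k) (z 0) (fun i => pencil_base a b 0 i) hD.
split=> //; rewrite [LHS]E !lin_evalE !rmorph_sum /= mulr_sumr -big_split /=.
apply: eq_bigr => i _; rewrite !mxE; exact: (mul_lin_rmorph (@ratfunC k)).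
Qed.

End PencilCoef.

(** * Line-sections *)

Lemma lineP (k : fieldType) (l v : 'rV[k]_3) :
  line l v <-> v != 0 /\ lin_eval l^T v = 0.
Proof.
rewrite /line /lin_eval /=; split=> -[v0 E]; split=> //; first by rewrite E mxE.
by rewrite [LHS]mx11_scalar E -scalemx1 scale0r.
Qed.

Lemma ratfunX_lin_eq0 (k : fieldType) (c d : k) :
  ratfunX k * ratfunC c + ratfunC d = 0 -> c = 0 /\ d = 0.
Proof.
have -> : ratfunX k * ratfunC c + ratfunC d = ('X * c%:P + d%:P)%:F.
  by rewrite tofracD tofracM.
move=> /eqP; rewrite tofrac_eq0 => /eqP E; split.
  by have := congr1 (fun p : {poly k} => p`_1) E; rewrite coefD coefXM !coefC /= addr0.
by have := congr1 (fun p : {poly k} => p`_0) E; rewrite coefD coefXM !coefC /= add0r.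
Qed.

(** The homogeneous coordinates of a point of the generic line of abscissa
    [x = p / q], multiplied by [q]. *)
Lemma clear_denominator (A B : comNzRingType) (phi : {rmorphism A -> B})
    (x t q p : B) (z a b : A) : x * q = p ->
  q * (x * phi z + (t * phi a + phi b)) = p * phi z + q * (t * phi a + phi b).
Proof. by move=> <-; ring. Qed.

Lemma solve_linear (A B : fieldType) (phi : {rmorphism A -> B})
    (x t : B) (c a b : A) : c != 0 ->
  x * phi c + (t * phi a + phi b) = 0 ->
  x = t * phi (- a / c) + phi (- b / c).
Proof.
move=> c0 E; have pc0 : phi c != 0 by rewrite fmorph_eq0.
apply: (mulIf pc0).
rewrite !rmorphM !rmorphN !fmorphV mulrDl mulrA !mulfVK//.
by apply/eqP; rewrite -subr_eq0 mulrN -opprD opprK E.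
Qed.

(** A line-section is an affine point whose abscissa is linear in [t], and its
    image is the line with the corresponding equation. Indeed every
    specialization [t = s] of a point of abscissa [p / q] lies on its image; if
    the image is the line [L = 0], then [L] vanishes at infinitely many such
    specializations, hence at the generic point itself. *)
Lemma line_sectionP (k : numFieldType) (F : {mpoly k[3]}) (z a b : 'rV[k]_3)
    (fx fs fu : 'cV[k]_3) (P : ec_point (ratfun k)) :
  dual_frame z a b fx fs fu -> line_section F z a b P ->
  exists (al be : k) (w : ratfun k),
    [/\ P = ECaff (ratfunX k * ratfunC al + ratfunC be) w,
        w ^+ 2 = (pencil_cubic F z a b).[ratfunX k * ratfunC al + ratfunC be] &
        fbar z a b P = [set v | v != 0 /\
          lin_eval fx v = al * lin_eval fs v + be * lin_eval fu v]].
Proof.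
move=> df [PF [l l0 fE]].
have [dfv dfc] := df; have [zx zs zu] := dual_frame_z df.
pose L := lin_eval l^T.
have LE X S U : L (X *: z + S *: a + U *: b) = X * L z + S * L a + U * L b.
  by rewrite /L !lin_evalD !lin_evalZ.
have Lv v : L v = lin_eval fx v * L z + lin_eval fs v * L a + lin_eval fu v * L b.
  by rewrite {1}[v]dfv LE.
have L0 : ~ [/\ L z = 0, L a = 0 & L b = 0].
  move=> [z0 a0 b0]; move/negP: l0; apply; apply/eqP/rowP => i.
  have : L (delta_mx 0 i) = 0 by rewrite Lv z0 a0 b0 !mulr0 !addr0.
  by rewrite /L /lin_eval -rowE !mxE.
case: P PF fE => [|x w] PF fE.
  (* The image of the zero section is the point [z] only. *)
  have vanish f v : lin_eval f z = 0 -> L v = 0 -> lin_eval f v = 0.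
    move=> fz Lv0; have [->|v0] := eqVneq v 0.
      by rewrite lin_evalE big1// => i _; rewrite mxE mul0r.
    have : line l v by apply/lineP.
    rewrite -fE => -[_ /(_ 1%N (lin_form f) (lin_form_homog f))].
    rewrite meval_lin_form; apply.
    have := rmorph_mmap (@ratfunC k) idfun (z 0) (lin_form f).
    rewrite -[mmap idfun _ _]/((lin_form f).@[z 0]) meval_lin_form fz rmorph0 => ->.
    by apply: mmap_ext => // i; rewrite /= mxE.
  exfalso; apply: L0.
  (* The line [L = 0] contains these three vectors. *)
  have P1 : L (L a *: z + (- L z) *: a + 0 *: b) = 0 by rewrite LE; ring.
  have P2 : L (L b *: z + 0 *: a + (- L z) *: b) = 0 by rewrite LE; ring.
  have P3 : L (0 *: z + L b *: a + (- L a) *: b) = 0 by rewrite LE; ring.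
  have := vanish _ _ zs P1; have := vanish _ _ zs P3; have := vanish _ _ zu P3.
  case: (dfc (L a) (- L z) 0) => _ -> _; case: (dfc 0 (L b) (- L a)) => _ -> ->.
  by move=> /eqP; rewrite oppr_eq0 => /eqP-> -> /eqP; rewrite oppr_eq0 => /eqP->.
have [p [q [q0 _ pq]]] := ratfun_coprime x.
have Lpt s : L (p.[s] *: z + (q.[s] * s) *: a + q.[s] *: b) = 0.
  set v := _ + _ + _; have [->|v0] := eqVneq v 0.
    by rewrite /L lin_evalE big1// => i _; rewrite mxE mul0r.
  suff /lineP[]// : line l v by [].
  rewrite -fE; split=> // d G hG G0.
  pose h (i : 'I_3) : {poly k} :=
    p * (z 0 i)%:P + q * ('X * (a 0 i)%:P + (b 0 i)%:P).
  have h0 : mmap polyC h G = 0.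
    apply/eqP; rewrite -tofrac_eq0 -mmap_ratfunC_tofrac; apply/eqP.
    have := mmap_scale (@ratfunC k) (fbar_generic z a b (ECaff x w) 0) (q%:F) hG.
    rewrite G0 mulr0 => E; rewrite -[RHS]E; apply: mmap_ext => // i.
    rewrite !mxE; apply: esym; rewrite /h tofracD tofracM tofracM tofracD tofracM.
    exact: (clear_denominator (@ratfunC k)).
  have := mmap_polyC_horner G h s; rewrite h0 horner0 => E; rewrite [RHS]E.
  by apply: meval_eq => i; rewrite /h /v !mxE !hornerE /=; ring.
have E : x * ratfunC (L z) + (ratfunX k * ratfunC (L a) + ratfunC (L b)) = 0.
  have qF0 : q%:F != 0 by rewrite tofrac_eq0.
  apply: (mulfI qF0); rewrite (clear_denominator (@ratfunC k) _ _ _ _ pq).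
  rewrite mulr0 -tofrac0.
  transitivity ((p * (L z)%:P + q * ('X * (L a)%:P + (L b)%:P))%:F).
    by rewrite tofracD tofracM tofracM tofracD tofracM.
  congr tofrac; apply: poly_infinite_roots => s _.
  by rewrite -[RHS](Lpt s) LE !hornerE /=; ring.
have z0 : L z != 0.
  apply/eqP => z0; apply: L0; move: E; rewrite z0.
  have -> : ratfunC 0 = 0 :> ratfun k by exact: (rmorph0 (@ratfunC k)).
  by rewrite mulr0 add0r => /ratfunX_lin_eq0[].
exists (- L a / L z), (- L b / L z), w.
have xE := solve_linear z0 E.
rewrite -xE; split=> //.
rewrite fE; apply/seteqP; split=> v.
  move=> /lineP[v0 Ev]; split=> //; move: Ev; rewrite -/L Lv => Ev.
  apply: (mulIf z0); apply/eqP; rewrite -subr_eq0; apply/eqP; rewrite -[RHS]Ev.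
  by field.
move=> [v0 Ev]; apply/lineP; split=> //; rewrite -/L Lv Ev; by field.
Qed.

(** * Degrees of the coefficients of the parabola *)

(** The equations obtained when the leading coefficient of the parabola is that of
    [g]: solving the coefficient of degree 3 for [b ^+ 2] and that of degree 2
    for [c * C], the coefficient of degree 1 becomes a monic cubic equation for
    [2 B]. *)
Lemma parabola_elim (K : fieldType) (g : {poly K})
    (B C b x1 x2 x3 x4 : K) : (size g <= 4)%N -> g`_3 != 0 ->
  parabola_meets g g`_3 B C b x1 x2 x3 x4 ->
  let c := g`_3 in
  let e1 := x1 + x2 + (x3 + x4) in
  let e2 := x1 * x2 + (x1 + x2) * (x3 + x4) + x3 * x4 in
  let e3 := x1 * x2 * (x3 + x4) + (x1 + x2) * (x3 * x4) in
  let e4 := x1 * x2 * (x3 * x4) in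
  [/\ b ^+ 2 = B *+ 2 + c * e1,
      C ^+ 2 = b ^+ 2 * g`_0 + c ^+ 2 * e4 &
      (B *+ 2) ^+ 3 = - ((c * (c * e1 * g`_1 - c ^+ 2 * e3)) *+ 8) +
        (c ^+ 2 * e2 + c * e1 * g`_2 - c * g`_1 *+ 2) *+ 4 * (B *+ 2) +
        g`_2 *+ 4 * (B *+ 2) ^+ 2].
Proof.
move=> sg c0 /(parabola_meetsP _ _ _ _ _ _ _ _ sg)[F3 F2 F1 F0] c e1 e2 e3 e4.
rewrite -/c -/e1 in F3; rewrite -/c -/e2 in F2; rewrite -/c -/e3 in F1.
rewrite -/c -/e4 in F0; rewrite -/c in c0; clearbody c e1 e2 e3 e4.
have bE : b ^+ 2 = B *+ 2 + c * e1.
  by apply: (mulfI c0); apply/eqP; rewrite -subr_eq0 -oppr_eq0 -F3; apply/eqP; ring.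
split=> //.
  by apply/eqP; rewrite -subr_eq0; apply/eqP; rewrite -[RHS]F0; ring.
have B2 : B ^+ 2 = b ^+ 2 * g`_2 + c ^+ 2 * e2 - 2 * c * C.
  by apply/eqP; rewrite -subr_eq0; apply/eqP; rewrite -[RHS]F2; ring.
have BC : 2 * B * C = b ^+ 2 * g`_1 - c ^+ 2 * e3.
  by apply/eqP; rewrite -subr_eq0; apply/eqP; rewrite -[RHS]F1; ring.
have -> : (B *+ 2) ^+ 3 = 8 * B * B ^+ 2 by ring.
rewrite B2.
have -> : 8 * B * (b ^+ 2 * g`_2 + c ^+ 2 * e2 - 2 * c * C) =
  8 * B * (b ^+ 2 * g`_2 + c ^+ 2 * e2) - 8 * c * (2 * B * C) by ring.
by rewrite BC bE; ring.
Qed.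

Lemma parabola_scale (K : fieldType) (g : {poly K})
    (A B C b x1 x2 x3 x4 : K) : b != 0 ->
  parabola_meets g A B C b x1 x2 x3 x4 ->
  parabola_meets g (A / b) (B / b) (C / b) 1 x1 x2 x3 x4.
Proof.
rewrite /parabola_meets => b0 E.
have bV : (b^-1)%:P * b%:P = 1 by rewrite -polyCM mulVf.
pose q := A%:P * 'X ^+ 2 + B%:P * 'X + C%:P.
transitivity ((b^-1)%:P ^+ 2 * q ^+ 2 - ((b^-1)%:P * b%:P) ^+ 2 * g).
  by rewrite bV /q !polyCM polyC1; ring.
transitivity ((b^-1)%:P ^+ 2 * (q ^+ 2 - b%:P ^+ 2 * g)); first by ring.
by rewrite E !polyCM; ring.
Qed.

(** A parabola [w = ga x^2 + B x + C] is determined by [ga] and by the abscissas of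
    its four intersections with the curve. *)
Lemma parabola_elim1 (K : fieldType) (g : {poly K})
    (ga B C x1 x2 x3 x4 : K) : (2 : K) != 0 -> (size g <= 4)%N -> ga != 0 ->
  parabola_meets g ga B C 1 x1 x2 x3 x4 ->
  B = (2 * ga)^-1 * (g`_3 - ga ^+ 2 * (x1 + x2 + (x3 + x4))) /\
  C = (2 * ga)^-1 *
    (ga ^+ 2 * (x1 * x2 + (x1 + x2) * (x3 + x4) + x3 * x4) + g`_2 - B ^+ 2).
Proof.
move=> n2 sg ga0 /(parabola_meetsP _ _ _ _ _ _ _ _ sg)[F3 F2 _ _].
have u0 : 2 * ga != 0 by rewrite mulf_neq0.
split; apply: (mulfI u0); rewrite mulVKf//; apply/eqP; rewrite -subr_eq0.
  by apply/eqP; rewrite -[RHS]F3; ring.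
by apply/eqP; rewrite -[RHS]F2; ring.
Qed.

Section Bounds.
Variable k : numFieldType.
Implicit Types f : ratfun k.

Lemma polyfracMn n f m : polyfrac n f -> polyfrac n (f *+ m).
Proof.
move=> [p -> sp]; exists (p *+ m); first by rewrite tofracMn.
by rewrite -scaler_nat (leq_trans (size_scale_leq _ _)).
Qed.

Lemma polyfrac_sqrt N f : polyfrac (N * 2).+1 (f ^+ 2) -> polyfrac N.+1 f.
Proof.
move=> hf; apply: (@polyfrac_integral _ 2 N (fun i => if i == 0 then f ^+ 2 else 0)) => //.
  by move=> i; case: eqP => [->|_]; [rewrite subn0 | apply: polyfrac0].
by rewrite !big_ord_recr big_ord0 /= add0r expr0 mulr1 mul0r addr0.
Qed.

Lemma polyfrac_cubic N a0 a1 a2 f :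
  polyfrac (N * 3).+1 a0 -> polyfrac (N * 2).+1 a1 -> polyfrac N.+1 a2 ->
  f ^+ 3 = a0 + a1 * f + a2 * f ^+ 2 -> polyfrac N.+1 f.
Proof.
move=> h0 h1 h2 E.
apply: (@polyfrac_integral _ 3 N (fun i => nth 0 [:: a0; a1; a2] i)) => //.
  by case=> [[|[|[|//]]]] i /=; rewrite ?subn0 ?muln1.
by rewrite !big_ord_recr big_ord0 /= add0r expr0 mulr1 expr1.
Qed.

Lemma ratfun_natr_neq0 n : (n.+1%:R : ratfun k) != 0.
Proof.
have -> : n.+1%:R = (n.+1%:R : {poly k})%:F :> ratfun k by rewrite tofracMn tofrac1.
by rewrite tofrac_eq0 -polyC_natr polyC_eq0 pnatr_eq0.
Qed.

(** When the [x_i] are linear in [t] and [g`_j] has degree at most [4 - j], the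
    coefficients [B], [C] and [b] of the parabola are polynomials in [t] of
    degrees at most 2, 3 and 1. *)
Lemma parabola_bounds (g : {poly ratfun k}) (B C b x1 x2 x3 x4 : ratfun k) :
  (size g <= 4)%N -> g`_3 != 0 ->
  (forall j, polyfrac (5 - j) g`_j) ->
  polyfrac 2 x1 -> polyfrac 2 x2 -> polyfrac 2 x3 -> polyfrac 2 x4 ->
  parabola_meets g g`_3 B C b x1 x2 x3 x4 ->
  [/\ polyfrac 3 B, polyfrac 4 C & polyfrac 2 b].
Proof.
move=> sg c0 hg h1 h2 h3 h4 /(parabola_elim sg c0).
set e1 := _ + _; set e2 := _ + x3 * x4; set e3 := _ + (x1 + x2) * _.
set e4 := _ * (x3 * x4) => -[bE CE BE].
have p12 := polyfracM h1 h2; have p34 := polyfracM h3 h4.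
have s12 := polyfracD h1 h2; have s34 := polyfracD h3 h4.
have he1 : polyfrac 2 e1 by apply: polyfracD.
have he2 : polyfrac 3 e2.
  by apply: polyfracD => //; apply: polyfracD => //; exact: (polyfracM s12 s34).
have he3 : polyfrac 4 e3.
  by apply: polyfracD; [exact: (polyfracM p12 s34) | exact: (polyfracM s12 p34)].
have he4 : polyfrac 5 e4 by exact: (polyfracM p12 p34).
have hg3 : polyfrac 2 g`_3 := hg 3; have hg2 : polyfrac 3 g`_2 := hg 2.
have hg1 : polyfrac 4 g`_1 := hg 1; have hg0 : polyfrac 5 g`_0 := hg 0.
have hcc : polyfrac 3 (g`_3 ^+ 2) by exact: (polyfracM hg3 hg3).
have hce1 : polyfrac 3 (g`_3 * e1) := polyfracM hg3 he1.
have hB2 : polyfrac 3 (B *+ 2).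
  apply: (@polyfrac_cubic 2) BE; last exact: polyfracMn.
    apply/polyfracN/polyfracMn; apply: (polyfracM hg3 (n := 6)).
    by apply: polyfracB; [exact: (polyfracM hce1 hg1) | exact: (polyfracM hcc he3)].
  apply/polyfracMn/polyfracB; last exact/polyfracMn/(polyfracM hg3 hg1).
  by apply: polyfracD; [exact: (polyfracM hcc he2) | exact: (polyfracM hce1 hg2)].
have hb2 : polyfrac 3 (b ^+ 2) by rewrite bE; apply: polyfracD.
split; last exact: (@polyfrac_sqrt 1).
  have -> : B = ratfunC 2^-1 * (B *+ 2).
    apply: (mulfI (ratfun_natr_neq0 1)); rewrite mulrA.
    have -> : 2%:R * ratfunC 2^-1 = 1 :> ratfun k.
      rewrite -[2%:R](rmorph_nat (@ratfunC k)) -(rmorphM (@ratfunC k)) mulfV ?pnatr_eq0//.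
    by rewrite mul1r mulr_natl.
  exact: polyfracZ.
apply: (@polyfrac_sqrt 3); rewrite CE.
by apply: polyfracD; [exact: (polyfracM hb2 hg0) | exact: (polyfracM hcc he4)].
Qed.

End Bounds.

(** * From the generic fibre to forms on the plane *)

Lemma rmorph_meets (A B : comNzRingType) (phi : {rmorphism A -> B})
   (a p e f l1 l2 l3 l4 : A) :
  phi (p ^+ 2 - e ^+ 2 * f - a ^+ 2 * (l1 * l2 * l3 * l4)) =
  phi p ^+ 2 - phi e ^+ 2 * phi f -
  phi a ^+ 2 * (phi l1 * phi l2 * phi l3 * phi l4).
Proof. by rewrite !(rmorphB, rmorphM, rmorphXn). Qed.

Lemma rmorph_quadratic (A B : comNzRingType) (phi : {rmorphism A -> B})
   (a b c x : A) :
  phi (a * x ^+ 2 + b * x + c) = phi a * phi x ^+ 2 + phi b * phi x + phi c.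
Proof. by rewrite !(rmorphD, rmorphM, rmorphXn). Qed.

Lemma root_polyE (A B : comNzRingType) (phi : {rmorphism A -> B})
    (t : B) (r1 r2 : A) :
  'X - (phi r1)%:P * t%:P - (phi r2)%:P * 1 = 'X - (t * phi r1 + phi r2)%:P.
Proof. by rewrite polyCD polyCM; ring. Qed.

Lemma proj_pointZ (k : fieldType) (c : k) (v : 'rV[k]_3) : c != 0 ->
  proj_point (c *: v) = proj_point v.
Proof.
move=> c0; have E : (c *: v :=: v)%MS by exact: eqmx_scale.
by apply/seteqP; split=> u -[u0 uv]; split=> //; move: uv; rewrite !E.
Qed.

Section Forms.
Variables (k : numFieldType) (F : {mpoly k[3]}) (z a b : 'rV[k]_3).
Variables (fx fs fu : 'cV[k]_3).
Hypothesis hF : F \is 4.-homog.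
Hypothesis fr : is_frame z a b.
Hypothesis df : dual_frame z a b fx fs fu.

(** A pair [r] encodes the line [fx = r.1 * fs + r.2 * fu], of equation
    [root_form r]; it cuts the generic line at the abscissa [root_val r]. *)
Definition root_val (r : k * k) : ratfun k :=
  ratfunX k * ratfunC r.1 + ratfunC r.2.

Definition root_form (r : k * k) : {mpoly k[3]} :=
  lin_form fx - r.1 *: lin_form fs - r.2 *: lin_form fu.

Lemma root_form_homog r : root_form r \is 1.-homog.
Proof. by rewrite !rpredB ?dhomogZ ?lin_form_homog. Qed.

Lemma meval_root_form r (v : 'rV[k]_3) : (root_form r).@[v 0] =
  lin_eval fx v - r.1 * lin_eval fs v - r.2 * lin_eval fu v.
Proof. by rewrite !mevalB !mevalZ !meval_lin_form. Qed.

Lemma pencil_root_form r : pencil_cubic (root_form r) z a b =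
  'X - (root_val r)%:P.
Proof.
rewrite /pencil_cubic !mmapB !mmapZ.
case: (pencil_dual df); rewrite /pencil_cubic => -> -> ->.
exact: (root_polyE (@ratfunC k)).
Qed.

Local Notation binary_form := (binary_form fs fu).

(** The form of degree [e + 2] that restricts to [pA x^2 + pB x + pC] on the generic
    line. *)
Definition parabola_form e (pA pB pC : {poly k}) : {mpoly k[3]} :=
  binary_form e pA * lin_form fx ^+ 2 + binary_form e.+1 pB * lin_form fx +
  binary_form e.+2 pC.

Lemma parabola_form_homog e pA pB pC :
  parabola_form e pA pB pC \is (e + 2).-homog.
Proof.
apply: dhomogD; first apply: dhomogD.
- have := dhomogM (binary_form_homog fs fu e pA) (dhomogMn 2 (lin_form_homog fx)).
  by rewrite mul1n.
- have := dhomogM (binary_form_homog fs fu e.+1 pB) (lin_form_homog fx).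
  by rewrite addn1 addn2.
- by have := binary_form_homog fs fu e.+2 pC; rewrite addn2.
Qed.

(** The identity [parabola_meets] over [k(t)], homogenized: it holds at every point
    of the plane. *)
Lemma parabola_meets_forms e (pA pB pC pb : {poly k}) r1 r2 r3 r4 :
  (size pA <= e.+1)%N -> (size pB <= e.+2)%N -> (size pC <= e.+3)%N ->
  (size pb <= e.+1)%N ->
  parabola_meets (pencil_cubic F z a b) pA%:F pB%:F pC%:F pb%:F
    (root_val r1) (root_val r2) (root_val r3) (root_val r4) ->
  forall v : 'rV[k]_3, (parabola_form e pA pB pC).@[v 0] ^+ 2 -
    (binary_form e pb).@[v 0] ^+ 2 * F.@[v 0] =
    (binary_form e pA).@[v 0] ^+ 2 *
    ((root_form r1).@[v 0] * (root_form r2).@[v 0] *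
     (root_form r3).@[v 0] * (root_form r4).@[v 0]).
Proof.
move=> sA sB sC sb meets v; apply/eqP; rewrite -subr_eq0; apply/eqP.
pose D := parabola_form e pA pB pC ^+ 2 - binary_form e pb ^+ 2 * F -
  binary_form e pA ^+ 2 *
  (root_form r1 * root_form r2 * root_form r3 * root_form r4).
transitivity D.@[v 0].
  by rewrite /D (rmorph_meets (meval (v 0))).
apply: (@pencil_eq0 _ _ _ _ _ (e * 2 + 4)) fr _ _ v.
  have R r := root_form_homog r.
  apply: rpredB; first apply: rpredB.
  - have := dhomogMn 2 (parabola_form_homog e pA pB pC).
    by rewrite mulnDl.
  - exact: (dhomogM (dhomogMn 2 (binary_form_homog fs fu e pb)) hF).
  - apply: (dhomogM (dhomogMn 2 (binary_form_homog fs fu e pA))).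
    exact: (dhomogM (dhomogM (dhomogM (R r1) (R r2)) (R r3)) (R r4)).
rewrite /D /pencil_cubic rmorph_meets /parabola_form rmorph_quadratic /=.
rewrite -!/(pencil_cubic _ z a b).
rewrite !pencil_root_form !(pencil_binary_form df)//.
case: (pencil_dual df) => -> _ _.
by rewrite meets subrr.
Qed.

End Forms.

(** * The tangent line at the base point *)

Section Tangent.
Variables (k : numFieldType) (F : {mpoly k[3]}) (z a b : 'rV[k]_3).
Variables (fx fs fu : 'cV[k]_3).
Hypothesis df : dual_frame z a b fx fs fu.
Hypothesis gp : general_smooth_point F z.

Local Notation ta := (lin_eval (gradient F z)^T a).
Local Notation tb := (lin_eval (gradient F z)^T b).

Lemma tangent_through : lin_eval (gradient F z)^T z = 0.
Proof.
case: gp => [[z0 _] _ [p [q [_ _ _ E]]]].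
have : (proj_point z `|` proj_point p `|` proj_point q) z.
  by left; left; split=> //; rewrite !submx_refl.
by rewrite -E => -[/lineP[]].
Qed.

(** In the coordinates of the frame, the tangent line at [z] has equation
    [fs * ta + fu * tb = 0], where [ta] and [tb] are the derivatives of [F] at [z]
    along [a] and [b]. *)
Lemma tangent_lin_eval v :
  lin_eval (gradient F z)^T v = lin_eval fs v * ta + lin_eval fu v * tb.
Proof.
by rewrite {1}[v](df.1) !lin_evalD !lin_evalZ tangent_through mulr0 add0r.
Qed.

Lemma tangent_neq0 : ~ (ta = 0 /\ tb = 0).
Proof.
move=> [a0 b0]; case: gp => _ /negP g0 _; apply: g0; apply/eqP/rowP => i.
have : lin_eval (gradient F z)^T (delta_mx 0 i) = 0.
  by rewrite tangent_lin_eval a0 b0 !mulr0 addr0.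
by rewrite /lin_eval -rowE !mxE.
Qed.

(** Parametrization of the tangent line at [z]. *)
Definition tangent_pt (x r : k) : 'rV[k]_3 :=
  x *: z + (r * tb) *: a + (- r * ta) *: b.

Lemma tangent_ptP v : lin_eval (gradient F z)^T v = 0 ->
  exists x r, v = tangent_pt x r.
Proof.
rewrite tangent_lin_eval => E; exists (lin_eval fx v).
suff [r [rS rU]] : exists r, lin_eval fs v = r * tb /\ lin_eval fu v = - r * ta.
  by exists r; rewrite /tangent_pt -rS -rU -(df.1 v).
have [a0|a0] := eqVneq ta 0; last first.
  exists (- lin_eval fu v / ta); split; last by rewrite -mulNr opprK mulfVK.
  apply: (mulIf a0); apply/eqP; rewrite -subr_eq0; apply/eqP; rewrite -[RHS]E.
  by field.
have b0 : tb != 0 by apply/eqP => b0; apply: tangent_neq0.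
exists (lin_eval fs v / tb); split; first by rewrite mulfVK.
move/eqP: E; rewrite a0 !mulr0 add0r mulf_eq0 (negbTE b0) orbF => /eqP->//.
Qed.

Lemma tangent_pt_coord x r : [/\ lin_eval fx (tangent_pt x r) = x,
  lin_eval fs (tangent_pt x r) = r * tb & lin_eval fu (tangent_pt x r) = - r * ta].
Proof. exact: df.2. Qed.

Lemma tangent_pt_line x r : lin_eval (gradient F z)^T (tangent_pt x r) = 0.
Proof.
rewrite tangent_lin_eval; case: (tangent_pt_coord x r) => _ -> ->; ring.
Qed.

Lemma tangent_pt_inj x r y s : tangent_pt x r = tangent_pt y s -> x = y /\ r = s.
Proof.
move=> E; case: (tangent_pt_coord x r); case: (tangent_pt_coord y s).
rewrite E => -> -> -> xy Eb Ea; split=> //; apply: contrapT => rs.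
have rs0 : r - s != 0 by apply/negP => /eqP; move/subr0_eq.
apply: tangent_neq0; split; apply: (mulfI rs0); rewrite mulr0.
  by rewrite mulrBl; move: Ea; rewrite !mulNr => /oppr_inj->; rewrite subrr.
by rewrite mulrBl Eb subrr.
Qed.

Lemma tangent_ptZ c x r : c *: tangent_pt x r = tangent_pt (c * x) (c * r).
Proof. by rewrite /tangent_pt !scalerDr !scalerA !mulrA mulrN. Qed.

Lemma tangent_pt0 x : tangent_pt x 0 = x *: z.
Proof. by rewrite /tangent_pt mul0r oppr0 mul0r !scale0r !addr0. Qed.

(** The quartic does not restrict to the tangent line at [z] as the product of
    the square of the equation of [z] and of a further square: the two other
    points of intersection would coincide. *)
Lemma tangent_not_square (beta gamma delta : k) :
  (forall x r, (r ^+ 2 * beta * x + r ^+ 3 * gamma) ^+ 2 =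
    (r * delta) ^+ 2 * F.@[(tangent_pt x r) 0]) -> delta = 0.
Proof.
move=> sq; apply: contrapT => /eqP d0.
case: gp => [[z0 _] _ [p [q [p0 q0 [pz qz pq] E]]]].
have onF x r : r != 0 ->
    F.@[(tangent_pt x r) 0] = 0 <-> beta * x + gamma * r = 0.
  move=> r0; have rd : (r * delta) ^+ 2 != 0 by rewrite expf_neq0 ?mulf_neq0.
  have r20 : r ^+ 2 != 0 by rewrite expf_neq0.
  have -> : beta * x + gamma * r = (r ^+ 2)^-1 * (r ^+ 2 * beta * x + r ^+ 3 * gamma).
    by field.
  split=> [F0|].
    have := sq x r; rewrite F0 mulr0 => /eqP; rewrite sqrf_eq0 => /eqP->.
    by rewrite mulr0.
  move=> /eqP; rewrite mulf_eq0 invr_eq0 (negbTE r20) /= => /eqP s0.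
  by apply: (mulfI rd); rewrite -sq s0 expr0n mulr0.
have other v : v != 0 -> proj_point v <> proj_point z -> 
    (proj_point z `|` proj_point p `|` proj_point q) v ->
    exists x r, [/\ v = tangent_pt x r, r != 0 & beta * x + gamma * r = 0].
  move=> v0 vz; rewrite -E => -[/lineP[_ /tangent_ptP[x [r vE]]] [_ Fv]].
  have r0 : r != 0.
    apply/eqP => r0; apply: vz; rewrite vE r0 tangent_pt0 proj_pointZ//.
    by apply: contraNneq v0 => x0; rewrite vE r0 tangent_pt0 x0 scale0r.
  by exists x, r; split=> //; apply/(onF _ _ r0); rewrite -vE.
have [xp [rp [pE rp0 hp]]] : exists x r,
    [/\ p = tangent_pt x r, r != 0 & beta * x + gamma * r = 0].
  by apply: other => //; left; right; split=> //; rewrite !submx_refl.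
have [xq [rq [qE rq0 hq]]] : exists x r,
    [/\ q = tangent_pt x r, r != 0 & beta * x + gamma * r = 0].
  by apply: other => //; right; split=> //; rewrite !submx_refl.
have det0 : rq * xp != rp * xq.
  apply/eqP => e; apply: pq; rewrite pE qE.
  rewrite -[RHS](@proj_pointZ _ (rp / rq)); last by rewrite mulf_neq0 ?invr_eq0.
  rewrite tangent_ptZ; congr (proj_point (tangent_pt _ _)); last by rewrite mulfVK.
  by rewrite mulrAC -e mulrAC mulfV// mul1r.
have beta0 : beta = 0.
  have d : rq * xp - rp * xq != 0 by rewrite subr_eq0.
  apply: (mulIf d); rewrite mul0r.
  transitivity (rq * (beta * xp + gamma * rp) - rp * (beta * xq + gamma * rq)).
    by ring.
  by rewrite hp hq !mulr0 subrr.
have gamma0 : gamma = 0.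
  by apply: (mulIf rp0); rewrite mul0r -hp beta0 mul0r add0r.
(* The quartic would contain the tangent line, hence a fourth point of it. *)
pose v := tangent_pt (rq * xp + rp * xq) (2 * (rp * rq)).
have r0 : 2 * (rp * rq) != 0 by rewrite !mulf_neq0 ?pnatr_eq0.
have v0 : v != 0.
  apply/eqP => v0; have : v = tangent_pt 0 0 by rewrite tangent_pt0 scale0r.
  by move=> /tangent_pt_inj[_ /eqP]; rewrite (negbTE r0).
have : (proj_point z `|` proj_point p `|` proj_point q) v.
  rewrite -E; split; first by apply/lineP; split=> //; apply: tangent_pt_line.
  by split=> //; apply/(onF _ _ r0); rewrite beta0 gamma0 !mul0r addr0.
have multiple w : proj_point w v -> exists c, v = c *: w.
  by move=> [_ /andP[/sub_rVP]].
case=> [[]|] /multiple[c].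
- rewrite -tangent_pt0 => /tangent_pt_inj[_ /eqP]; by rewrite (negbTE r0).
- rewrite pE tangent_ptZ => /tangent_pt_inj[ex er].
  have cE : c = 2 * rq by apply: (mulIf rp0); rewrite -er; ring.
  move/eqP: det0; apply; apply/eqP; rewrite -subr_eq0; apply/eqP.
  transitivity (c * xp - (rq * xp + rp * xq)); last by rewrite ex subrr.
  by rewrite cE; ring.
- rewrite qE tangent_ptZ => /tangent_pt_inj[ex er].
  have cE : c = 2 * rp by apply: (mulIf rq0); rewrite -er; ring.
  move/eqP: det0; apply; apply/eqP; rewrite -subr_eq0; apply/eqP.
  transitivity ((rq * xp + rp * xq) - c * xq); last by rewrite ex subrr.
  by rewrite cE; ring.
Qed.

(** The linear form [pb] vanishes on the tangent line at [z], i.e. is proportional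
    to the equation [pA] of that line. *)
Lemma tangent_coef_eq (pA pB pC pb : {poly k}) (T : 'rV[k]_3 -> k) :
  (forall v : 'rV[k]_3,
    (parabola_form fx fs fu 1 pA pB pC).@[v 0] ^+ 2 -
    (binary_form fs fu 1 pb).@[v 0] ^+ 2 * F.@[v 0] =
    (binary_form fs fu 1 pA).@[v 0] ^+ 2 * T v) ->
  pA`_1 = ta -> pA`_0 = tb -> pb`_1 * tb = pb`_0 * ta.
Proof.
move=> sq A1 A0; apply/eqP; rewrite -subr_eq0; apply/eqP.
(* On [tangent_pt x r] the forms [pb], [pB] and [pC] are [r], [r ^+ 2] and [r ^+ 3]
   times constants, the last two being [be] and [ga]. *)
pose be := pB`_0 * ta ^+ 2 - pB`_1 * ta * tb + pB`_2 * tb ^+ 2.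
pose ga := - pC`_0 * ta ^+ 3 + pC`_1 * ta ^+ 2 * tb - pC`_2 * ta * tb ^+ 2 +
  pC`_3 * tb ^+ 3.
apply: (@tangent_not_square be ga) => x r.
have := sq (tangent_pt x r); rewrite /parabola_form mevalD mevalD !mevalM.
rewrite !meval_lin_form !meval_binary_form.
case: (tangent_pt_coord x r) => -> -> ->.
rewrite !big_ord_recr !big_ord0 /= A1 A0 /be /ga => e.
apply/eqP; rewrite -subr_eq0; apply/eqP.
match type of e with ?l = ?t => transitivity (l - t) end; first by ring.
by rewrite e subrr.
Qed.

End Tangent.

(** * The conic through the points of intersection *)

Lemma proportional2 (k : fieldType) (a b c d : k) :
  ~ (a = 0 /\ b = 0) -> c * b = d * a -> exists e, c = e * a /\ d = e * b.
Proof.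
move=> ab E; have [a0|a0] := eqVneq a 0.
  have b0 : b != 0 by apply/eqP => b0; apply: ab.
  exists (d / b); split; last by rewrite mulfVK.
  by apply: (mulIf b0); rewrite E a0 !mulr0 mul0r.
exists (c / a); split; first by rewrite mulfVK.
by apply: (mulIf a0); rewrite -E; field.
Qed.

Lemma divf_scale (K : fieldType) (c d e : K) : c != 0 -> e * d = 1 -> c / (d * c) = e.
Proof.
move=> c0 E; have d0 : d != 0.
  by apply/eqP => d0; move/eqP: E; rewrite d0 mulr0 eq_sym oner_eq0.
by apply: (mulIf d0); rewrite E; field; rewrite d0 c0.
Qed.

Section Conic.
Variables (k : numFieldType) (F : {mpoly k[3]}) (z a b : 'rV[k]_3).
Hypothesis hF : F \is 4.-homog.
Hypothesis gp : general_smooth_point F z.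

Local Notation ta := (lin_eval (gradient F z)^T a).
Local Notation tb := (lin_eval (gradient F z)^T b).
Local Notation g := (pencil_cubic F z a b).

(** As [z] lies on the quartic, [F(x z + t a + b)] has degree at most 3 in [x]. *)
Lemma size_pencil_cubic : (size g <= 4)%N.
Proof.
have [sg g4 _] := mmap_line_top_coef (@ratfunC k) (z 0)
  (fun i => pencil_base a b 0 i) hF.
apply/leq_sizeP => j; rewrite leq_eqVlt => /orP[/eqP<-|j4].
  rewrite [LHS]g4; case: gp => [[_ ->] _ _]; exact: (rmorph0 (@ratfunC k)).
by rewrite nth_default// (leq_trans _ j4).
Qed.

Lemma pencil_cubic_lead : g`_3 = ('X * ta%:P + tb%:P)%:F.
Proof.
have [_] := pencil_top_coef z a b hF.
by rewrite coefXM /= tofracD tofracM.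
Qed.

Lemma polyfrac_root_val (r : k * k) : polyfrac 2 (root_val r).
Proof.
apply: polyfracD; first exact: (polyfracM (polyfracX k) (polyfracC _)).
exact: polyfrac_widen (polyfracC _).
Qed.

(** The coefficient [be] of [w] is a constant multiple of the leading
    coefficient of the cubic. *)
Lemma parabola_lead_const (be B C : ratfun k) (r1 r2 r3 r4 : k * k) :
  is_frame z a b -> be != 0 ->
  parabola_meets g g`_3 B C be
    (root_val r1) (root_val r2) (root_val r3) (root_val r4) ->
  exists2 c, c != 0 & be = ratfunC c * g`_3.
Proof.
move=> fr be0 meets; have [fx [fs [fu df]]] := frame_dual fr.
have T0 : ~ (ta = 0 /\ tb = 0) := tangent_neq0 df gp.
have g30 : g`_3 != 0.
  apply/eqP => g30; apply: T0; apply: ratfunX_lin_eq0.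
  by rewrite -g30 pencil_cubic_lead tofracD tofracM.
have [] := parabola_bounds size_pencil_cubic g30 (pencil_coef_polyfrac z a b hF)
  (polyfrac_root_val r1) (polyfrac_root_val r2) (polyfrac_root_val r3)
  (polyfrac_root_val r4) meets.
move=> [pB BE sB] [pC CE sC] [pb bE sb].
pose pA : {poly k} := 'X * ta%:P + tb%:P.
have A1 : pA`_1 = ta by rewrite coefD coefXM !coefC /= addr0.
have A0 : pA`_0 = tb by rewrite coefD coefXM !coefC /= add0r.
have sA : (size pA <= 2)%N.
  apply/leq_sizeP => j j2; rewrite coefD coefXM !coefC.
  by case: j j2 => [|[|j]]//= _; rewrite addr0.
move: meets; rewrite pencil_cubic_lead BE CE bE => meets.
have sq := parabola_meets_forms hF fr df sA sB sC sb meets.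
have [c [c1 c0]] := proportional2 T0 (tangent_coef_eq df gp sq A1 A0).
have pbE : pb = c%:P * pA.
  apply/polyP => i; rewrite coefCM; case: i => [|[|i]]; rewrite ?A0 ?A1//.
  by rewrite !nth_default ?mulr0// ?(leq_trans sA) ?(leq_trans sb).
exists c; last by rewrite pbE tofracM.
by apply: contraNneq be0 => c00; rewrite bE pbE c00 polyC0 mul0r tofrac0.
Qed.

(** If the leading coefficient of a parabola [w = ga x^2 + B x + C] is a constant,
    then [B] and [C] are polynomials in [t] of degrees at most 1 and 2, so that
    the parabola is the trace of a conic of the plane. *)
Lemma polyfrac_parabola_elim1 (ga : k) (x1 x2 x3 x4 B C : ratfun k) :
  ga != 0 -> polyfrac 2 x1 -> polyfrac 2 x2 -> polyfrac 2 x3 -> polyfrac 2 x4 ->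
  parabola_meets g (ratfunC ga) B C 1 x1 x2 x3 x4 ->
  polyfrac 2 B /\ polyfrac 3 C.
Proof.
move=> ga0 h1 h2 h3 h4 meets.
have gF0 : ratfunC ga != 0 :> ratfun k by rewrite tofrac_eq0 polyC_eq0.
have [BE CE] := parabola_elim1 (ratfun_natr_neq0 k 1) size_pencil_cubic gF0 meets.
have gaV : (2 * ratfunC ga)^-1 = ratfunC (2 * ga)^-1 :> ratfun k.
  by rewrite (fmorphV (@ratfunC k)) (rmorphM (@ratfunC k)) (rmorph_nat (@ratfunC k)).
have s12 := polyfracD h1 h2; have s34 := polyfracD h3 h4.
have hg j := pencil_coef_polyfrac z a b hF j.
have ga2 n f : polyfrac n f -> polyfrac n (ratfunC ga ^+ 2 * f).
  by move=> hf; rewrite expr2 -mulrA; apply/polyfracZ/polyfracZ.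
have hB : polyfrac 2 B.
  rewrite BE gaV; apply/polyfracZ/polyfracB; first exact: (hg 3).
  by apply/ga2/polyfracD.
split=> //; rewrite CE gaV; apply/polyfracZ/polyfracB; last exact: (polyfracM hB hB).
apply: polyfracD; last exact: (hg 2); apply/ga2.
apply: polyfracD; last exact: (polyfracM h3 h4).
apply: polyfracD; [exact: (polyfracM h1 h2) | exact: (polyfracM s12 s34)].
Qed.

(** The theorem for an arbitrary quartic form, over any [numFieldType]. *)
Lemma line_sections_conic (s1 s2 s3 : ec_point (ratfun k)) :
  is_frame z a b ->
  line_section F z a b s1 -> line_section F z a b s2 ->
  line_section F z a b s3 ->
  let s4 := MWadd F z a b (MWadd F z a b s1 s2) s3 in
  line_section F z a b s4 ->
  fbar z a b s1 <> fbar z a b s2 -> fbar z a b s1 <> fbar z a b s3 ->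
  fbar z a b s2 <> fbar z a b s3 ->
  on_a_conic (curve F `&` (fbar z a b s1 `|` fbar z a b s2 `|`
                           fbar z a b s3 `|` fbar z a b s4)).
Proof.
move=> fr ls1 ls2 ls3 s4 ls4 n12 n13 n23.
have [fx [fs [fu df]]] := frame_dual fr.
have [al1 [be1 [w1 [s1E w1E fb1]]]] := line_sectionP df ls1.
have [al2 [be2 [w2 [s2E w2E fb2]]]] := line_sectionP df ls2.
have [al3 [be3 [w3 [s3E w3E fb3]]]] := line_sectionP df ls3.
have [al4 [be4 [w4 [s4E w4E fb4]]]] := line_sectionP df ls4.
pose r1 := (al1, be1); pose r2 := (al2, be2); pose r3 := (al3, be3).
pose r4 := (al4, be4).
have T0 : ~ (ta = 0 /\ tb = 0) := tangent_neq0 df gp.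
have g30 : g`_3 != 0.
  apply/eqP => g30; apply: T0; apply: ratfunX_lin_eq0.
  by rewrite -g30 pencil_cubic_lead tofracD tofracM.
have x12 : root_val r1 != root_val r2.
  by apply/eqP => e; apply: n12; rewrite s1E s2E /fbar /= -[X in X *: _ + _]/(root_val r1) e.
have x13 : root_val r1 != root_val r3.
  by apply/eqP => e; apply: n13; rewrite s1E s3E /fbar /= -[X in X *: _ + _]/(root_val r1) e.
have x23 : root_val r2 != root_val r3.
  by apply/eqP => e; apply: n23; rewrite s2E s3E /fbar /= -[X in X *: _ + _]/(root_val r2) e.
have addE : ec_add g (ec_add g (ECaff (root_val r1) w1) (ECaff (root_val r2) w2))
    (ECaff (root_val r3) w3) = ECaff (root_val r4) w4.
  by rewrite -[RHS]s4E /s4 /MWadd s1E s2E s3E.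
have [be [B [C [be0 meets]]]] : exists be B C, be != 0 /\
    parabola_meets g g`_3 B C be
      (root_val r1) (root_val r2) (root_val r3) (root_val r4).
  exact: ec_add3_parabola (ratfun_natr_neq0 k 1) size_pencil_cubic g30
    w1E w2E w3E x12 x13 x23 addE.
have [c c0 beE] := parabola_lead_const fr be0 meets.
have := parabola_scale be0 meets; move: (B / be) (C / be) => B' C'.
have -> : g`_3 / be = ratfunC c^-1.
  rewrite beE; apply: divf_scale => //.
  by rewrite -(rmorphM (@ratfunC k)) mulVf//; exact: (rmorph1 (@ratfunC k)).
have c'0 : c^-1 != 0 by rewrite invr_eq0.
move: {c c0 beE} (c^-1) c'0 => ga ga0 meets'.
have [[pB BE sB] [pC CE sC]] := polyfrac_parabola_elim1 ga0
  (polyfrac_root_val r1) (polyfrac_root_val r2) (polyfrac_root_val r3)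
  (polyfrac_root_val r4) meets'.
have sA : (size (ga%:P : {poly k}) <= 1)%N by rewrite size_polyC_leq1.
have sb : (size (1%R : {poly k}) <= 1)%N by rewrite size_poly1.
rewrite BE CE -[X in parabola_meets _ _ _ _ X]tofrac1 in meets'.
have sq := parabola_meets_forms hF fr df sA sB sC sb meets'.
exists (parabola_form fx fs fu 0 ga%:P pB pC); split.
- (* The value of the conic at [z] is [ga]. *)
  apply: contraNneq ga0 => G0.
  have : (parabola_form fx fs fu 0 ga%:P pB pC).@[z 0] = 0 by rewrite G0 meval0.
  rewrite /parabola_form mevalD mevalD !mevalM !meval_lin_form !meval_binary_form.
  case: (dual_frame_z df) => -> -> ->; rewrite !big_ord_recr !big_ord0 /= coefC /=.
  by move=> e; apply/eqP; rewrite -[RHS]e; ring.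
- exact: (parabola_form_homog fx fs fu 0).
move=> v [[v0 Fv] vs]; split=> //.
have root r : lin_eval fx v = r.1 * lin_eval fs v + r.2 * lin_eval fu v ->
    (root_form fx fs fu r).@[v 0] = 0.
  by rewrite meval_root_form => ->; ring.
apply/eqP; rewrite -sqrf_eq0; apply/eqP.
have := sq v; rewrite Fv mulr0 subr0 => ->.
case: vs => [[[]|]|]; [rewrite fb1|rewrite fb2|rewrite fb3|rewrite fb4].
- by move=> [_ /(root r1)->]; ring.
- by move=> [_ /(root r2)->]; ring.
- by move=> [_ /(root r3)->]; ring.
- by move=> [_ /(root r4)->]; ring.
Qed.

End Conic.

Theorem theorem0p4 (R : realType) (F : {mpoly R[i][3]})
    (z a b : 'rV[R[i]]_3) (s1 s2 s3 : ec_point (ratfun R[i])) :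
  irreducible_singular_quartic F \/ two_conics F ->
  general_smooth_point F z ->
  is_frame z a b ->
  line_section F z a b s1 ->
  line_section F z a b s2 ->
  line_section F z a b s3 ->
  let s4 := MWadd F z a b (MWadd F z a b s1 s2) s3 in
  line_section F z a b s4 ->
  fbar z a b s1 <> fbar z a b s2 ->
  fbar z a b s1 <> fbar z a b s3 ->
  fbar z a b s2 <> fbar z a b s3 ->
  on_a_conic (curve F `&` (fbar z a b s1 `|` fbar z a b s2 `|`
                           fbar z a b s3 `|` fbar z a b s4)).
Proof.
move=> hQ gp fr ls1 ls2 ls3 s4 ls4 n12 n13 n23.
have hF : F \is 4.-homog.
  case: hQ => [[]//|[G [H [[hG _] [hH _] _ ->]]]].
  exact: (dhomogM hG hH).
exact: line_sections_conic ls1 ls2 ls3 ls4 n12 n13 n23.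
Qed.
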